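(* Let $F=(\phi,\psi):\mathbb{D}^2\to\mathbb{D}^2$ be holomorphic, with $\phi$ a left Type I function and $\psi$ a right Type II function. Let $\tau^1\in\mathbb{T}$ denote the common Denjoy-Wolff point of all slice functions $\phi_\mu$, $\mu\in\mathbb{D}$. If there exists $\sigma\in\mathbb{T}$ such that $(\tau^1,\sigma)$ is a right Type II DW point for $\psi$ but not a C-point for $\phi$, then the iterates $F^n$ converge to $(\tau^1,\sigma)$ uniformly on compact subsets of $\mathbb{D}^2$.
   Context: Notation. $\mathbb{D}$ is the open unit disk, $\mathbb{T}=\partial\mathbb{D}$, $\mathrm{cl}$ denotes closure. Superscripts $1,2$ on points are coordinate indices: $\lambda=(\lambda^1,\lambda^2)$. $\|(\lambda^1,\lambda^2)\|=\max\{|\lambda^1|,|\lambda^2|\}$. $\pi^i(\lambda)=\lambda^i$ are the coordinate projections on $\mathbb{D}^2$. $F^n=F\circ\cdots\circ F$ ($n$ times). For $\phi:\mathbb{D}^2\to\mathbb{D}$, $\phi_\mu(\lambda)=\phi(\lambda,\mu)$ and $\widetilde\phi(\lambda^1,\lambda^2)=\phi(\lambda^2,\lambda^1)$. Models. A model $(\mathcal{M},u)$ for a holomorphic $\phi:\mathbb{D}^2\to\mathbb{D}$ consists of a separable Hilbert space with orthogonal decomposition $\mathcal{M}=\mathcal{M}^1\oplus\mathcal{M}^2$ and a holomorphic map $u:\mathbb{D}^2\to\mathcal{M}$, $\lambda\mapsto u_\lambda$, such that for all $\lambda,\mu\in\mathbb{D}^2$, $1-\phi(\lambda)\overline{\phi(\mu)}=(1-\lambda^1\overline{\mu^1})\langle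 u^1_\lambda,u^1_\mu\rangle+(1-\lambda^2\overline{\mu^2})\langle u^2_\lambda,u^2_\mu\rangle$, where $v^j$ is the orthogonal projection of $v\in\mathcal{M}$ onto $\mathcal{M}^j$. Every such $\phi$ has a model. Boundary points. A set $S\subset\mathbb{D}^2$ approaches $\tau\in\partial\mathbb{D}^2$ nontangentially if $\tau\in\mathrm{cl}(S)$ and there is $c>0$ with $\|\tau-\lambda\|\le c(1-\|\lambda\|)$ for all $\lambda\in S$. $\tau\in\partial\mathbb{D}^2$ is a B-point for $\phi$ if $\liminf_{\lambda\to\tau}\frac{1-|\phi(\lambda)|}{1-\|\lambda\|}<\infty$; then the nontangential limit of $\phi$ at $\tau$ exists and is denoted $\phi(\tau)$. A B-point $\tau$ is a C-point if $\phi$ has an angular gradient at $\tau$, i.e. there is $\eta\in\mathbb{C}^2$ with $\phi(\lambda)=\phi(\tau)+\eta^1(\lambda^1-\tau^1)+\eta^2(\lambda^2-\tau^2)+o(\|\lambda-\tau\|)$ as $\lambda\to\tau$ nontangentially. For a B-point $\tau$, $Y_\tau$ is the set of weak limits in $\mathcal{M}$ of weakly convergent sequences $\{u_{\lambda_n}\}$, over sequences $\lambda_n\to\tau$ in $\mathbb{D}^2$ for which $\frac{1-|\phi(\lambda_n)|}{1-\|\lambda_n\|}$ stays bounded. Types of functions. $\phi$ is a left Type I function if $\phi\ne\pi^1$ and there is $\tau^1\in\mathbb{T}$ that is the Denjoy-Wolff point of $\phi_\mu:\mathbb{D}\to\mathbb{D}$ for every $\mu\in\mathbb{D}$. $\phi$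 is a left Type II function if $\phi\ne\pi^1$ and there is a holomorphic $\xi:\mathbb{D}\to\mathbb{D}$ such that for all $\lambda,\mu\in\mathbb{D}$: $\phi_\mu(\lambda)=\lambda$ if and only if $\xi(\mu)=\lambda$. $\phi$ is a right Type I (resp. II) function if $\widetilde\phi$ is a left Type I (resp. II) function. (For a holomorphic $f:\mathbb{D}\to\mathbb{D}$ without fixed points, its Denjoy-Wolff point is the point of $\mathbb{T}$ to which the iterates of $f$ converge.) DW points. For $\phi\ne\pi^1$ with model $(\mathcal{M},u)$: a point $(\tau^1,\sigma)\in\mathbb{T}\times\mathrm{cl}(\mathbb{D})$ is a left Type I DW point for $\phi$ if it is a B-point, $\phi(\tau^1,\sigma)=\tau^1$, and there exists $v\in Y_{(\tau^1,\sigma)}$ with $\|v^1\|\le1$ and $v^2=0$. A point $\tau=(\tau^1,\tau^2)\in\mathbb{T}^2$ is a left Type II DW point for $\phi$ if it is a B-point, $\phi(\tau)=\tau^1$, there exists $u_\tau\in Y_\tau$ with $\|u^1_\tau\|<1$, and $\tau$ is not a left Type I DW point for $\phi$. If $\phi\ne\pi^2$, $(\tau^1,\tau^2)\in\mathbb{T}^2$ is a right Type II DW point for $\phi$ if $(\tau^2,\tau^1)$ is a left Type II DW point for $\widetilde\phi$. (These notions do not depend on the choice of model.) *)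

(* Defs.v *)
From HB Require Import structures.
From mathcomp Require Import all_boot all_order all_algebra.
From mathcomp Require Import all_classical all_reals all_analysis.
From mathcomp Require Import complex.

Set Implicit Arguments.
Unset Strict Implicit.
Unset Printing Implicit Defensive.

Import Order.TTheory GRing.Theory Num.Theory.
Import numFieldNormedType.Exports.

Local Open Scope classical_set_scope.
Local Open Scope ring_scope.

(* R[i] as a normed module over itself: the library provides this for
   abstract numFieldTypes only. *)
HB.instance Definition _ (R : realType) :=
  PseudoPointedMetric.copy R[i] (R[i])^o.
HB.instance Definition _ (R : realType) := NormedModule.copy R[i] (R[i])^o.

(* The product norm on C * C is the maximum norm, and its values, like those
   of every norm over R[i], are elements of R[i]; [rnorm] is the real-valued
   norm. *)
Definition rnorm (R : realType) (V : normedModType R[i]) (v : V) : R :=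
  complex.Re `|v|.

Section Bidisk.
Context {R : realType}.
Local Notation C := R[i].

Definition disk : set C := [set z | `|z| < 1].
Definition circle : set C := [set z | `|z| = 1].
Definition bidisk : set (C * C) := disk `*` disk.

(* [differentiable] over the scalar field R[i] asks for a complex-linear
   Frechet differential. *)
Definition holomorphic_on (V W : normedModType C) (A : set V) (f : V -> W) :=
  forall x, A x -> differentiable f x.

(* Maps on the disk or the bidisk are total functions on C or C * C; only
   their values on the (bi)disk are ever used. *)
Definition holo_self_disk (f : C -> C) :=
  holomorphic_on disk f /\ (forall z, disk z -> disk (f z)).
Definition holo_self_bidisk (F : C * C -> C * C) :=
  holomorphic_on bidisk F /\ (forall l, bidisk l -> bidisk (F l)).

Definition slice (phi : C * C -> C) (mu : C) : C -> C := fun z => phi (z, mu).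
Definition flip (phi : C * C -> C) : C * C -> C := fun l => phi (l.2, l.1).

Definition is_pi1 (phi : C * C -> C) := forall l, bidisk l -> phi l = l.1.

End Bidisk.

Record hilbertSpace (R : realType) := HilbertSpace {
  hcarrier :> completeNormedModType R[i];
  (* linear in the first argument, conjugate-linear in the second *)
  hdot : {dot hcarrier for Num.conj};
  hdot_norm : forall v : hcarrier, `|v| ^+ 2 = hdot v v
}.
Arguments hdot {R} h.

Definition separable (T : topologicalType) :=
  exists2 A : set T, countable A & dense A.

Definition weak_cvg (R : realType) (H : hilbertSpace R) (x : nat -> H) (v : H) :=
  forall w : H, hdot H (x n) w @[n --> \oo] --> hdot H v w.

(* An orthogonal decomposition H = H1 (+) H2; [pr1] and [pr2] are the
   orthogonal projections onto the two summands. *)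
Record orthoDecomp (R : realType) (H : hilbertSpace R) := OrthoDecomp {
  summand1 : set H;
  summand2 : set H;
  summand1_subspace : summand1 0 /\
    forall (a : R[i]) x y, summand1 x -> summand1 y -> summand1 (a *: x + y);
  summand2_subspace : summand2 0 /\
    forall (a : R[i]) x y, summand2 x -> summand2 y -> summand2 (a *: x + y);
  summand1_closed : closed summand1;
  summand2_closed : closed summand2;
  summands_ortho :
    forall x y, summand1 x -> summand2 y -> hdot H x y = 0;
  pr1 : H -> H;
  pr2 : H -> H;
  pr1_in : forall v, summand1 (pr1 v);
  pr2_in : forall v, summand2 (pr2 v);
  pr_sum : forall v, v = pr1 v + pr2 v
}.

Record model (R : realType) (phi : R[i] * R[i] -> R[i]) := Model {
  mspace : hilbertSpace R;
  mspace_separable : separable mspace;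
  mdec : orthoDecomp mspace;
  mmap : R[i] * R[i] -> mspace;
  mmap_holo : holomorphic_on bidisk mmap;
  model_eq : forall l m, bidisk l -> bidisk m ->
    1 - phi l * (phi m)^* =
      (1 - l.1 * (m.1)^*) * hdot mspace (pr1 mdec (mmap l)) (pr1 mdec (mmap m)) +
      (1 - l.2 * (m.2)^*) * hdot mspace (pr2 mdec (mmap l)) (pr2 mdec (mmap m))
}.

Section BoundaryPoints.
Context {R : realType}.
Local Notation C := R[i].
Implicit Types (phi : C * C -> C) (S : set (C * C)) (tau : C * C).

Definition approaches_nt S tau :=
  S `<=` bidisk /\ closure S tau /\
  exists2 c : C, 0 < c & forall l, S l -> `|tau - l| <= c * (1 - `|l|).

Definition julia_quotient phi (l : C * C) : R :=
  (1 - rnorm (phi l : C)) / (1 - rnorm l).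

(* `|tau| = 1 says that tau lies on the topological boundary of the bidisk. *)
Definition B_point phi tau :=
  `|tau| = 1 /\
  (limf_einf (fun l => (julia_quotient phi l)%:E) (within bidisk (nbhs tau))
    < +oo)%E.

Definition nt_limit phi tau (w : C) :=
  forall S, approaches_nt S tau -> phi l @[l --> within S (nbhs tau)] --> w.

(* [w] is the value phi(tau), the nontangential limit at the B-point. *)
Definition C_point phi tau :=
  B_point phi tau /\
  exists2 w : C, nt_limit phi tau w &
  exists eta : C * C, forall S, approaches_nt S tau ->
    forall e : C, 0 < e -> \forall l \near within S (nbhs tau),
      `|phi l - (w + eta.1 * (l.1 - tau.1) + eta.2 * (l.2 - tau.2))|
        <= e * `|l - tau|.

(* Weak limits of u along sequences tending to tau with bounded quotient;
   usually written Y_tau. *)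
Definition cluster_vectors phi (M : model phi) tau : set (mspace M) :=
  [set v | exists l : nat -> C * C,
    [/\ forall n, bidisk (l n),
        l n @[n --> \oo] --> tau,
        exists c : R, forall n, julia_quotient phi (l n) <= c
      & weak_cvg (fun n => mmap M (l n)) v]].

End BoundaryPoints.
Arguments cluster_vectors {R phi} M tau.

Section Types.
Context {R : realType}.
Local Notation C := R[i].
Implicit Types (f : C -> C) (phi psi : C * C -> C) (tau : C * C).

Definition DW_point f (t : C) :=
  [/\ holo_self_disk f,
      forall z, disk z -> f z <> z,
      circle t
    & forall z, disk z -> iter n f z @[n --> \oo] --> t].

Definition common_DW_point phi (t : C) :=
  circle t /\ forall mu, disk mu -> DW_point (slice phi mu) t.

Definition left_type1 phi :=
  ~ is_pi1 phi /\ exists t, common_DW_point phi t.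

Definition left_type2 phi :=
  ~ is_pi1 phi /\
  exists2 xi : C -> C, holo_self_disk xi &
    forall l mu, disk l -> disk mu -> (slice phi mu l = l <-> xi mu = l).

Definition right_type2 phi := left_type2 (flip phi).

Definition left_type1_DW_in phi (M : model phi) tau :=
  [/\ ~ is_pi1 phi,
      circle tau.1 /\ closure disk tau.2,
      B_point phi tau /\ nt_limit phi tau tau.1
    & exists2 v, cluster_vectors M tau v &
        `|pr1 (mdec M) v| <= 1 /\ pr2 (mdec M) v = 0].

Definition left_type2_DW_in phi (M : model phi) tau :=
  [/\ ~ is_pi1 phi,
      circle tau.1 /\ circle tau.2,
      B_point phi tau /\ nt_limit phi tau tau.1,
      exists2 v, cluster_vectors M tau v & `|pr1 (mdec M) v| < 1
    & ~ left_type1_DW_in M tau].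

(* The property does not depend on the model, and every holomorphic map from
   the bidisk to the disk has one. *)
Definition left_type2_DW phi tau := exists M : model phi, left_type2_DW_in M tau.

Definition right_type2_DW psi tau := left_type2_DW (flip psi) (tau.2, tau.1).

End Types.

(* Main.v *)
Require Import Defs.
From HB Require Import structures.
From mathcomp Require Import all_boot all_order all_algebra.
From mathcomp Require Import all_classical all_reals all_analysis.
From mathcomp Require Import complex ring lra.

(** Send tau1 and sigma to infinity by Cayley transforms, so that the bidisk
    becomes a product of two right half planes. The real part of the image of a
    point z is the reciprocal of [horo tau1 z], a function whose sublevel sets
    are the horodisks at tau1; convergence to (tau1, sigma) means that both
    horodisk functions tend to 0 along the orbit.

    Two inequalities control one step of F. Every slice of phi has Denjoy-Wolff
    point tau1, so Wolff's lemma ([wolff]) makes [horo tau1] decrease under phi: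
    in the half planes phi is (zeta, omega) |-> zeta + g(zeta, omega) with
    Re g >= 0. Passing to a weak limit v in a model of psi, with its variables
    exchanged, and applying the Cauchy-Schwarz inequality gives a Julia inequality ([model_julia])

      horo sigma (psi (z, w)) <= |v1|^2 horo sigma w + |v2|^2 horo tau1 z,

    whose first factor is smaller than 1 because (tau1, sigma) is a right Type
    II point. Hence [horo sigma] stays bounded along an orbit, and it tends to 0
    as soon as [horo tau1] does.

    That [horo tau1] tends to 0 is where the failure of the C-point condition
    enters. By Harnack's inequality Re g(t, t) / t decreases in t > 0 up to a
    constant factor, which leaves two cases. If Re g(t, t) / t comes arbitrarily
    close to 0, then g is of lower order than t on the diagonal and, by Harnack
    again, on nontangential approach regions; then phi agrees with the first
    coordinate to first order at (tau1, sigma), which is then a C-point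
    ([phi_C_point]). Otherwise Re g(zeta, omega) is at least a positive multiple
    of min(Re zeta, Re omega) everywhere ([diag_growth]). Along an orbit both
    real parts are bounded below, so Re zeta grows by a fixed amount at each
    step and [horo tau1] decays like 1/n ([coupled_decay]). All the bounds
    depend only on the initial values of the two horodisk functions, so the
    convergence is uniform on compact sets.

    Differentiability is only pointwise, so the function theory starts from
    Cauchy's theorem in Goursat's form, here for trapezoid sums instead of
    integrals ([goursat]). It gives an estimate at the centre of a disk, then
    the Schwarz lemma, the Schwarz-Pick inequality and its version for
    functions of nonnegative real part ([positive_pick]), which is the form of
    Harnack's inequality used above. *)

Set Implicit Arguments.
Unset Strict Implicit.
Unset Printing Implicit Defensive.
Import Order.TTheory GRing.Theory Num.Theory.
Import numFieldNormedType.Exports.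
Local Open Scope classical_set_scope.
Local Open Scope ring_scope.

(** * Modulus and real part *)

Section Modulus.
Context {R : realType}.
Local Notation C := R[i].
Implicit Types (z w : C) (x y : R).

Definition cmod z : R := Normc.normc z.
Definition cmod2 z : R := complex.Re z ^+ 2 + complex.Im z ^+ 2.
Definition rc x : C := Complex x 0.

Lemma normE z : `|z| = rc (cmod z). Proof. by []. Qed.
Lemma conjE z : z^* = conjc z. Proof. by []. Qed.

Lemma cmod_ge0 z : 0 <= cmod z.
Proof. by case: z => a b; rewrite /cmod /= sqrtr_ge0. Qed.

Lemma cmodM z w : cmod (z * w) = cmod z * cmod w.
Proof. exact: Normc.normcM. Qed.
Lemma cmodV z : cmod z^-1 = (cmod z)^-1.
Proof. exact: Normc.normcV. Qed.
Lemma cmodD z w : cmod (z + w) <= cmod z + cmod w.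
Proof. exact: le_normcD. Qed.
Lemma cmodN z : cmod (- z) = cmod z.
Proof. exact: normcN. Qed.
Lemma cmodB z w : cmod (z - w) <= cmod z + cmod w.
Proof. by rewrite -(cmodN w); exact: cmodD. Qed.
Lemma cmodBC z w : cmod (z - w) = cmod (w - z).
Proof. by rewrite -cmodN opprB. Qed.
Lemma cmod0 : cmod 0 = 0. Proof. exact: Normc.normc0. Qed.
Lemma cmod1 : cmod 1 = 1. Proof. exact: Normc.normc1. Qed.
Lemma cmodX z n : cmod (z ^+ n) = cmod z ^+ n.
Proof. by elim: n => [|n IH]; rewrite ?expr0 ?cmod1 // !exprS cmodM IH. Qed.

Lemma sqr_cmod z : cmod z ^+ 2 = cmod2 z.
Proof. by case: z => a b; rewrite /cmod /= sqr_sqrtr // addr_ge0 ?sqr_ge0. Qed.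

Lemma cmod_conj z : cmod (conjc z) = cmod z.
Proof. by case: z => a b; rewrite /cmod /= sqrrN. Qed.

Lemma cmod_rc x : cmod (rc x) = `|x|.
Proof. by rewrite /cmod /= expr0n /= addr0 sqrtr_sqr. Qed.

Lemma cmod_eq0 z : (cmod z == 0) = (z == 0).
Proof.
by apply/eqP/eqP => [/Normc.eq0_normc//|->]; rewrite cmod0.
Qed.

Lemma cmod_gt0 z : (0 < cmod z) = (z != 0).
Proof. by rewrite lt_neqAle cmod_ge0 andbT eq_sym cmod_eq0. Qed.

Lemma cmod_le z x : 0 <= x -> (cmod z <= x) = (cmod2 z <= x ^+ 2).
Proof. by move=> x0; rewrite -sqr_cmod ler_sqr ?nnegrE ?cmod_ge0. Qed.

Lemma cmod_lt z x : 0 <= x -> (cmod z < x) = (cmod2 z < x ^+ 2).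
Proof. by move=> x0; rewrite -sqr_cmod ltr_sqr ?nnegrE ?cmod_ge0. Qed.

Lemma cmod2_ge0 z : 0 <= cmod2 z.
Proof. by rewrite addr_ge0 ?sqr_ge0. Qed.

Lemma cmod2_gt0 z : (0 < cmod2 z) = (z != 0).
Proof. by rewrite -sqr_cmod exprn_even_gt0 //= cmod_eq0. Qed.

Lemma cmod2M z w : cmod2 (z * w) = cmod2 z * cmod2 w.
Proof. by rewrite -!sqr_cmod cmodM exprMn. Qed.
Lemma cmod2V z : cmod2 z^-1 = (cmod2 z)^-1.
Proof. by rewrite -!sqr_cmod cmodV exprVn. Qed.

Lemma cmodBl z w : cmod z - cmod w <= cmod (z - w).
Proof. by rewrite lerBlDr -{1}(subrK w z); exact: cmodD. Qed.

Lemma Re_le_cmod z : complex.Re z <= cmod z.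
Proof.
case: z => a b; apply: le_trans (ler_norm _) _.
by rewrite /cmod /= -sqrtr_sqr ler_wsqrtr // lerDl sqr_ge0.
Qed.

Lemma Im_le_cmod z : complex.Im z <= cmod z.
Proof.
case: z => a b; apply: le_trans (ler_norm _) _.
by rewrite /cmod /= -sqrtr_sqr ler_wsqrtr // lerDr sqr_ge0.
Qed.

Lemma ReD z w : complex.Re (z + w) = complex.Re z + complex.Re w.
Proof. by case: z w => [a b] [c d]. Qed.
Lemma ReN z : complex.Re (- z) = - complex.Re z.
Proof. by case: z. Qed.

Lemma Re_ge_Ncmod z : - cmod z <= complex.Re z.
Proof. by rewrite lerNl -ReN -(cmodN z); exact: Re_le_cmod. Qed.

Lemma Re_rc x : complex.Re (rc x) = x. Proof. by []. Qed.
Lemma Re_conjc z : complex.Re (conjc z) = complex.Re z. Proof. by case: z. Qed.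

Lemma gt0_rc z : 0 < z -> exists2 x, z = rc x & 0 < x.
Proof.
by case: z => a b; rewrite ltcE /= => /andP[/eqP -> a0]; exists a.
Qed.

Lemma disk_cmod z : disk z <-> cmod z < 1.
Proof. by rewrite /disk /= normE; rewrite -(ltcR (cmod z) 1). Qed.
Lemma circle_cmod z : circle z <-> cmod z = 1.
Proof.
rewrite /circle /= normE; split => [/(congr1 (@complex.Re R))//|->//].
Qed.

Lemma rnormE z : rnorm z = cmod z. Proof. by []. Qed.

End Modulus.

(** * Cauchy's theorem by trapezoid sums *)

Section Goursat.
Context {R : realType}.
Local Notation C := R[i].
Implicit Types (E : R -> R -> C) (a b x y : R) (f : C -> C).

Definition mid a b : R := (a + b) / 2.

Fixpoint dsum E n a b : C :=
  if n is n'.+1 then dsum E n' a (mid a b) + dsum E n' (mid a b) b else E a b.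

Lemma dsum0 E a b : dsum E 0 a b = E a b. Proof. by []. Qed.
Lemma dsumS E n a b :
  dsum E n.+1 a b = dsum E n a (mid a b) + dsum E n (mid a b) b.
Proof. by []. Qed.

Lemma dsum_tele E (A : R -> C) n a b :
  (forall s t, E s t = A t - A s) -> dsum E n a b = A b - A a.
Proof.
move=> EA; elim: n a b => [|n IH] a b /=; first exact: EA.
by rewrite !IH; ring.
Qed.

Lemma mid_itv a b : a <= b -> a <= mid a b <= b.
Proof. by rewrite /mid => ab; apply/andP; split; lra. Qed.

Lemma dsumD E1 E2 n a b :
  dsum (fun s t => E1 s t + E2 s t) n a b = dsum E1 n a b + dsum E2 n a b.
Proof. by elim: n a b => [|n IH] a b //=; rewrite !IH; ring. Qed.

Lemma dsumZ (k : C) E n a b :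
  dsum (fun s t => k * E s t) n a b = k * dsum E n a b.
Proof. by elim: n a b => [|n IH] a b //=; rewrite !IH; ring. Qed.

Lemma dsum_le E n a b (K : R) : a <= b ->
  (forall s t, a <= s -> s <= t -> t <= b -> cmod (E s t) <= K * (t - s)) ->
  cmod (dsum E n a b) <= K * (b - a).
Proof.
elim: n a b => [|n IH] a b ab EK /=; first exact: EK.
have /andP[am mb] := mid_itv ab.
apply: le_trans (cmodD _ _) _.
have -> : K * (b - a) = K * (mid a b - a) + K * (b - mid a b) by ring.
by apply: lerD; apply: IH => // s t ? ? ?; apply: EK => //; lra.
Qed.

(** Twice the trapezoid rule on the segment [p, q]; it is exact, hence
    additive along a polygon, when f is affine. *)
Definition trap f (p q : C) : C := (f p + f q) * (q - p).

Definition cell_sum f (P : R -> R -> C) n x x' y y' : C :=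
  dsum (fun s t => trap f (P s y) (P t y)) n x x' +
  dsum (fun s t => trap f (P x' s) (P x' t)) n y y' -
  dsum (fun s t => trap f (P s y') (P t y')) n x x' -
  dsum (fun s t => trap f (P x s) (P x t)) n y y'.

Lemma cell_sum_split f P n x x' y y' :
  cell_sum f P n.+1 x x' y y' =
    cell_sum f P n x (mid x x') y (mid y y') +
    cell_sum f P n (mid x x') x' y (mid y y') +
    cell_sum f P n x (mid x x') (mid y y') y' +
    cell_sum f P n (mid x x') x' (mid y y') y'.
Proof. by rewrite /cell_sum /=; ring. Qed.

Definition cderiv_at f (p : C) := exists c : C, forall e, 0 < e ->
  exists2 d, 0 < d & forall z, cmod (z - p) < d ->
    cmod (f z - (f p + c * (z - p))) <= e * cmod (z - p).

Definition half (b : bool) (I : R * R) : R * R :=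
  if b then (I.1, mid I.1 I.2) else (mid I.1 I.2, I.2).

Lemma half_len (c : bool) (I : R * R) : (half c I).2 - (half c I).1 = (I.2 - I.1) / 2.
Proof. by case: c; rewrite /half /mid /=; lra. Qed.

Lemma half_sub (c : bool) (I : R * R) :
  I.1 <= I.2 -> I.1 <= (half c I).1 /\ (half c I).2 <= I.2.
Proof. by case: c; rewrite /half /mid /=; split; lra. Qed.

Lemma nested_point (J : nat -> R * R) :
  (forall k, (J k).1 <= (J k).2) ->
  (forall k, (J k).1 <= (J k.+1).1 /\ (J k.+1).2 <= (J k).2) ->
  exists x, forall k, (J k).1 <= x /\ x <= (J k).2.
Proof.
move=> J12 Jmono.
have lo m n : (m <= n)%N -> (J m).1 <= (J n).1.
  move=> /subnK <-; elim: (n - m)%N => [|k IH]; rewrite ?add0n // addSn.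
  exact: le_trans IH (Jmono _).1.
have hi m n : (m <= n)%N -> (J n).2 <= (J m).2.
  move=> /subnK <-; elim: (n - m)%N => [|k IH]; rewrite ?add0n // addSn.
  exact: le_trans (Jmono _).2 IH.
have cross m n : (J m).1 <= (J n).2.
  have [mn|/ltnW nm] := leqP m n.
    exact: le_trans (lo _ _ mn) (J12 n).
  exact: le_trans (J12 m) (hi _ _ nm).
exists (sup [set (J k).1 | k in setT]) => k; split.
  apply: ub_le_sup; last by exists k.
  by exists (J 0).2 => _ [m _ <-].
by apply: ge_sup => [|_ [m _ <-]//]; exists (J 0).1; exists 0%N.
Qed.

Lemma exp2_small (d : R) : 0 < d -> exists k, 2^-1 ^+ k < d.
Proof.
move=> d0; have := upper_nthrootP (leqnn (Num.Def.archi_bound d^-1)).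
set k := Num.Def.archi_bound _ => dk; exists k.
by rewrite exprVn invf_plt // posrE exprn_gt0.
Qed.

Lemma trap_split f (p c : C) (u v : C) :
  trap f u v =
    (2 * f p * v + c * (v - p) ^+ 2 - (2 * f p * u + c * (u - p) ^+ 2)) +
    ((f u - (f p + c * (u - p))) + (f v - (f p + c * (v - p)))) * (v - u).
Proof. by rewrite /trap; ring. Qed.

Lemma edge_sum_split f (p c : C) (g : R -> C) n a b :
  dsum (fun s t => trap f (g s) (g t)) n a b =
    (2 * f p * g b + c * (g b - p) ^+ 2 - (2 * f p * g a + c * (g a - p) ^+ 2)) +
    dsum (fun s t => ((f (g s) - (f p + c * (g s - p))) +
       (f (g t) - (f p + c * (g t - p)))) * (g t - g s)) n a b.
Proof.
rewrite -(@dsum_tele (fun s t => 2 * f p * g t + c * (g t - p) ^+ 2 -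
   (2 * f p * g s + c * (g s - p) ^+ 2))
   (fun t => 2 * f p * g t + c * (g t - p) ^+ 2) n a b) // -dsumD.
by congr (dsum _ _ _ _); apply/funext => s; apply/funext => t; exact: trap_split.
Qed.

(** Near a point of differentiability only the remainder contributes: the
    trapezoid sums of the affine part telescope around the cell. *)
Lemma cell_sum_small f (P : R -> R -> C) n x x' y y' (p c : C) (L e r : R) :
  x <= x' -> y <= y' -> 0 <= e -> 0 <= L -> 0 <= r ->
  (forall s t, x <= s -> s <= x' -> y <= t -> t <= y' ->
     cmod (P s t - p) <= r) ->
  (forall s t s' t', x <= s -> s <= x' -> y <= t -> t <= y' ->
     x <= s' -> s' <= x' -> y <= t' -> t' <= y' ->
     cmod (P s t - P s' t') <= L * (`|s - s'| + `|t - t'|)) ->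
  (forall s t, x <= s -> s <= x' -> y <= t -> t <= y' ->
     cmod (f (P s t) - (f p + c * (P s t - p))) <= e * r) ->
  cmod (cell_sum f P n x x' y y') <= 4 * e * r * L * ((x' - x) + (y' - y)).
Proof.
move=> xx yy e0 L0 r0 Pp PL fe.
rewrite /cell_sum !(edge_sum_split f p c).
set S1 := dsum _ _ _ _; set S2 := dsum _ _ _ _; set S3 := dsum _ _ _ _;
  set S4 := dsum _ _ _ _.
have side (h : R -> C) (u u' : R) : u <= u' ->
    (forall a, u <= a -> a <= u' -> cmod (f (h a) - (f p + c * (h a - p))) <= e * r) ->
    (forall a b, u <= a -> a <= b -> b <= u' -> cmod (h b - h a) <= L * (b - a)) ->
    cmod (dsum (fun a b => ((f (h a) - (f p + c * (h a - p))) +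
      (f (h b) - (f p + c * (h b - p)))) * (h b - h a)) n u u') <=
    2 * e * r * L * (u' - u).
  move=> uu hf hL; apply: dsum_le => // a b ua ab bu.
  rewrite cmodM -[in leRHS]mulrA; apply: ler_pM; rewrite ?cmod_ge0 ?hL //.
  apply: le_trans (cmodD _ _) _.
  by have := hf a ltac:(lra) ltac:(lra); have := hf b ltac:(lra) ltac:(lra); lra.
have horiz t : y <= t -> t <= y' -> forall a b, x <= a -> a <= b -> b <= x' ->
    cmod (P b t - P a t) <= L * (b - a).
  move=> ty ty' a b xa ab bx; apply: le_trans (PL _ _ _ _ _ _ _ _ _ _ _ _) _; try lra.
  by rewrite subrr normr0 addr0 ger0_norm // subr_ge0.
have vert s : x <= s -> s <= x' -> forall a b, y <= a -> a <= b -> b <= y' ->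
    cmod (P s b - P s a) <= L * (b - a).
  move=> sx sx' a b ya ab bY; apply: le_trans (PL _ _ _ _ _ _ _ _ _ _ _ _) _; try lra.
  by rewrite subrr normr0 add0r ger0_norm // subr_ge0.
have K1 : cmod S1 <= 2 * e * r * L * (x' - x).
  by apply: side; [exact: xx|move=> a *; apply: fe; lra|exact: horiz].
have K3 : cmod S3 <= 2 * e * r * L * (x' - x).
  by apply: side; [exact: xx|move=> a *; apply: fe; lra|exact: horiz].
have K2 : cmod S2 <= 2 * e * r * L * (y' - y).
  by apply: side; [exact: yy|move=> a *; apply: fe; lra|exact: vert].
have K4 : cmod S4 <= 2 * e * r * L * (y' - y).
  by apply: side; [exact: yy|move=> a *; apply: fe; lra|exact: vert].
set A := (X in cmod X <= _).
have -> : A = S1 + S2 - S3 - S4 by rewrite /A; ring.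
have D1 := cmodB (S1 + S2 - S3) S4.
have D2 := cmodB (S1 + S2) S3.
have D3 := cmodD S1 S2.
by lra.
Qed.

(** The mesh of a subcell is tied to that of the cell it comes from, so the
    lower bound is required for arbitrarily fine meshes rather than for a limit
    of the sums. *)
Definition bad_cell f P (e : R) (Q : (R * R) * (R * R)) := forall M, exists2 n,
  (M <= n)%N & e * (Q.1.2 - Q.1.1) * (Q.2.2 - Q.2.1) <
    cmod (cell_sum f P n Q.1.1 Q.1.2 Q.2.1 Q.2.2).

Lemma bad_cell_half f P e Q : bad_cell f P e Q ->
  exists b : bool * bool, bad_cell f P e (half b.1 Q.1, half b.2 Q.2).
Proof.
move=> bad; apply: contrapT => /forallNP nb.
have good (c : bool * bool) : exists M, forall n, (M <= n)%N ->
    cmod (cell_sum f P n (half c.1 Q.1).1 (half c.1 Q.1).2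
       (half c.2 Q.2).1 (half c.2 Q.2).2) <=
    e * ((Q.1.2 - Q.1.1) / 2) * ((Q.2.2 - Q.2.1) / 2).
  have /existsNP[M HM] := nb c; exists M => n Mn.
  rewrite -(half_len c.1 Q.1) -(half_len c.2 Q.2) leNgt; apply/negP => lt; apply: HM.
  by exists n.
have [M1 H1] := good (true, true); have [M2 H2] := good (false, true).
have [M3 H3] := good (true, false); have [M4 H4] := good (false, false).
have [[|n]] := bad (M1 + M2 + M3 + M4).+1; first by [].
rewrite ltnS => Mn; rewrite cell_sum_split.
have {}H1 := H1 n (leq_trans (leq_trans (leq_addr _ _)
  (leq_trans (leq_addr _ _) (leq_addr _ _))) Mn).
have {}H2 := H2 n (leq_trans (leq_trans (leq_addl _ _)
  (leq_trans (leq_addr _ _) (leq_addr _ _))) Mn).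
have {}H3 := H3 n (leq_trans (leq_trans (leq_addl _ _) (leq_addr _ _)) Mn).
have {}H4 := H4 n (leq_trans (leq_addl _ _) Mn).
move: H1 H2 H3 H4; rewrite /half /=.
set S1 := cell_sum _ _ _ _ _ _ _; set S2 := cell_sum _ _ _ _ _ _ _.
set S3 := cell_sum _ _ _ _ _ _ _; set S4 := cell_sum _ _ _ _ _ _ _.
move=> H1 H2 H3 H4.
have D1 := cmodD (S1 + S2 + S3) S4.
have D2 := cmodD (S1 + S2) S3.
have D3 := cmodD S1 S2.
by lra.
Qed.

(** Goursat's argument: a cell whose sums do not tend to 0 has a quarter with
    the same defect relative to its area. The nested cells shrink to a point,
    where differentiability makes the sums small compared with the area. *)
Theorem goursat f (P : R -> R -> C) (L : R) :
  (forall s t s' t', 0 <= s <= 1 -> 0 <= t <= 1 -> 0 <= s' <= 1 ->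
     0 <= t' <= 1 -> cmod (P s t - P s' t') <= L * (`|s - s'| + `|t - t'|)) ->
  (forall s t, 0 <= s <= 1 -> 0 <= t <= 1 -> cderiv_at f (P s t)) ->
  forall e, 0 < e -> exists M, forall n, (M <= n)%N ->
    cmod (cell_sum f P n 0 1 0 1) <= e.
Proof.
move=> PL fd e e0; apply: contrapT => /forallNP nM.
have bad0 : bad_cell f P e ((0, 1), (0, 1)).
  move=> M; have /existsNP[n /not_implyP[Mn H]] := nM M.
  exists n => //=; rewrite subr0 !mulr1 ltNge; exact/negP.
pose X := {Q | bad_cell f P e Q}.
pose T (Q Q' : X) :=
  exists b : bool * bool, sval Q' = (half b.1 (sval Q).1, half b.2 (sval Q).2).
have step (Q : X) : {Q' : X | T Q Q'}.
  have /cid[b Hb] := bad_cell_half (svalP Q).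
  by exists (exist _ _ Hb); exists b.
have [q [q0 qS]] := dependent_choice step (exist _ _ bad0).
have lenS k : ((sval (q k)).1.2 - (sval (q k)).1.1 = 2^-1 ^+ k) /\
              ((sval (q k)).2.2 - (sval (q k)).2.1 = 2^-1 ^+ k).
  elim: k => [|k [IH1 IH2]]; first by rewrite q0 /= subr0 expr0.
  have [b ->] := qS k; rewrite !half_len IH1 IH2 exprSr.
  by [].
have pos k : 0 < (2^-1 : R) ^+ k by rewrite exprn_gt0 // invr_gt0.
have mono1 k : (sval (q k)).1.1 <= (sval (q k)).1.2.
  by have := pos k; have [] := lenS k; lra.
have mono2 k : (sval (q k)).2.1 <= (sval (q k)).2.2.
  by have := pos k; have [] := lenS k; lra.
have [x xq] : exists x, forall k,
    (sval (q k)).1.1 <= x /\ x <= (sval (q k)).1.2.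
  apply: (@nested_point (fun k => (sval (q k)).1)) => // k.
  by have [b ->] := qS k; exact: half_sub.
have [y yq] : exists y, forall k,
    (sval (q k)).2.1 <= y /\ y <= (sval (q k)).2.2.
  apply: (@nested_point (fun k => (sval (q k)).2)) => // k.
  by have [b ->] := qS k; exact: half_sub.
have inunit k : [/\ 0 <= (sval (q k)).1.1, (sval (q k)).1.2 <= 1,
    0 <= (sval (q k)).2.1 & (sval (q k)).2.2 <= 1].
  elim: k => [|k [A1 A2 A3 A4]]; first by rewrite q0.
  have [b ->] := qS k => /=.
  have [] := half_sub b.1 (mono1 k); have [] := half_sub b.2 (mono2 k).
  by split; lra.
have [c Hc] : cderiv_at f (P x y).
  have := xq 0%N; have := yq 0%N; rewrite q0 /= => -[? ?] [? ?].
  by apply: fd; apply/andP.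
have L0 : 0 <= L.
  have := PL 0 0 1 0; rewrite !lexx ler01 => /(_ isT isT isT isT).
  rewrite subrr normr0 addr0 sub0r normrN1 mulr1; apply: le_trans.
  exact: cmod_ge0.
pose e' := e / (16 * L ^+ 2 + 1).
have den : 0 < 16 * L ^+ 2 + 1 by rewrite ltr_wpDl ?mulr_ge0 ?sqr_ge0.
have e'0 : 0 < e' by rewrite divr_gt0.
have [d d0 Hd] := Hc e' e'0.
have [k Hk] : exists k, 2^-1 ^+ k < d / (2 * L + 1).
  by apply: exp2_small; rewrite divr_gt0 // ltr_wpDl ?mulr_ge0.
have [n _] := svalP (q k) 0%N.
apply/negP; rewrite -leNgt.
have [l1 l2] := lenS k; have [x1 x2] := xq k; have [y1 y2] := yq k.
have [u1 u2 u3 u4] := inunit k.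
move: Hk (pos k) l1 l2; move: (2^-1 ^+ k) => h Hk h0 l1 l2.
move: (mono1 k) (mono2 k) l1 l2 x1 x2 y1 y2 u1 u2 u3 u4.
case: (sval (q k)) => [[xa xb] [ya yb]] /= xab yab l1 l2 x1 x2 y1 y2 u1 u2 u3 u4.
clear -PL Hd d0 e'0 L0 h0 Hk l1 l2 x1 x2 y1 y2 u1 u2 u3 u4 xab yab den e0.
have Pr s t : xa <= s -> s <= xb -> ya <= t -> t <= yb ->
     cmod (P s t - P x y) <= L * (2 * h).
  move=> s1 s2 t1 t2; apply: le_trans (PL _ _ _ _ _ _ _ _) _;
    try by apply/andP; split; lra.
  apply: ler_wpM2l => //.
  have : `|s - x| <= h by rewrite ler_norml; apply/andP; split; lra.
  have : `|t - y| <= h by rewrite ler_norml; apply/andP; split; lra.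
  by lra.
apply: le_trans (@cell_sum_small f P n _ _ _ _ (P x y) c L e' (L * (2 * h))
  xab yab (ltW e'0) L0 _ Pr _ _) _.
- by rewrite !mulr_ge0 // ltW.
- by move=> *; apply: PL; apply/andP; split; lra.
- move=> s t s1 s2 t1 t2.
  apply: le_trans (Hd _ _) _.
    apply: le_lt_trans (Pr _ _ s1 s2 t1 t2) _.
    move: Hk; rewrite ltr_pdivlMr ?ltr_wpDl ?mulr_ge0 //.
    by lra.
  by rewrite ler_pM2l //; exact: Pr.
- rewrite l1 l2.
  have -> : 4 * e' * (L * (2 * h)) * L * (h + h) = e' * (16 * L ^+ 2) * h ^+ 2.
    by ring.
  have -> : e * h * h = e * h ^+ 2 by ring.
  apply: ler_wpM2r; first exact: sqr_ge0.
  rewrite /e' mulrAC ler_pdivrMr // ler_wpM2l ?ltW //.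
  by lra.
Qed.

End Goursat.

(** * A maximum principle at the centre of a disk *)

Section Centre.
Context {R : realType}.
Local Notation C := R[i].
Implicit Types (f : C -> C) (z w : C).

Lemma differentiable_cderiv f z : differentiable f z -> cderiv_at f z.
Proof.
move=> df; exists ('d f z 1) => e e0.
have /eqaddoP/(_ (rc e)) := diff_locally df.
have e0C : 0 < rc e by rewrite ltcR.
move=> /(_ e0C) /nbhs_ballP[d /= d0 Hd].
have [x dx x0] := gt0_rc d0.
exists x => // w wz.
have := Hd (w - z); rewrite /ball /= sub0r normrN dx normE ltcR => /(_ wz).
have E : 'd f z (w - z) = 'd f z 1 * (w - z).
  by rewrite -[in LHS](mulr1 (w - z)) -[_ * 1]/((w - z) *: (1 : C)) linearZ /= mulrC.
rewrite !fctE /= subrK E => H.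
by rewrite -lecR rmorphM /=; exact: H.
Qed.

Lemma cderiv_cont f z : cderiv_at f z -> forall e, 0 < e ->
  exists2 d, 0 < d & forall w, cmod (w - z) < d -> cmod (f w - f z) <= e.
Proof.
move=> [c Hc] e e0; have [d d0 Hd] := Hc 1 ltr01.
have K0 : 0 < cmod c + 1 by rewrite ltr_wpDl ?cmod_ge0.
exists (Num.min d (e / (cmod c + 1))); first by rewrite lt_min d0 divr_gt0.
move=> w; rewrite lt_min => /andP[/Hd H1]; rewrite ltr_pdivlMr // => H2.
have -> : f w - f z = (f w - (f z + c * (w - z))) + c * (w - z) by ring.
apply: le_trans (cmodD _ _) _; rewrite cmodM.
by lra.
Qed.

Lemma expr_le_bound (a M K : R) : 0 <= a -> 0 <= M ->
  (forall k, a ^+ k <= K * M ^+ k) -> a <= M.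
Proof.
move=> a0 M0 H; rewrite leNgt; apply/negP => Ma.
have [M00|Mn0] := eqVneq M 0.
  by have := H 1%N; rewrite M00 !expr1 mulr0; lra.
have {Mn0}M0 : 0 < M by rewrite lt_neqAle eq_sym Mn0.
pose q := a / M - 1.
have q0 : 0 < q by rewrite subr_gt0 ltr_pdivlMr // mul1r.
have bern k : 1 + k%:R * q <= (a / M) ^+ k.
  have -> : a / M = 1 + q by rewrite /q; ring.
  elim: k => [|k IH]; first by rewrite mul0r addr0 expr0.
  rewrite exprS -natr1; set x := (1 + q) ^+ k in IH *.
  have kq : 0 <= k%:R * q * q by rewrite !mulr_ge0 // ltW.
  have : (1 + q) * (1 + k%:R * q) <= (1 + q) * x by rewrite ler_wpM2l //; lra.
  by nra.
have bd k : 1 + k%:R * q <= K.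
  apply: le_trans (bern k) _.
  by rewrite expr_div_n ler_pdivrMr ?exprn_gt0.
have := bd (Num.truncn (K / q)).+1.
have := truncnS_gt (K / q); rewrite ltr_pdivrMr //.
by lra.
Qed.

Lemma sin_lip (x y : R) : `|sin x - sin y| <= `|x - y|.
Proof.
wlog xy : x y / y < x.
  move=> H; have [/H//|/H|->] := ltgtP y x; last by rewrite !subrr.
  by rewrite distrC (distrC x).
have [c _ ->] := MVT xy (fun (u : R) _ => is_derive_sin u)
  (fun u : R => (@continuous_subspaceT _ _ _ _ (@continuous_sin R) u)).
by rewrite normrM ler_piMl // ler_norml cos_geN1 cos_le1.
Qed.

Lemma cos_lip (x y : R) : `|cos x - cos y| <= `|x - y|.
Proof.
wlog xy : x y / y < x.
  move=> H; have [/H//|/H|->] := ltgtP y x; last by rewrite !subrr.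
  by rewrite distrC (distrC x).
have [c _ ->] := MVT xy (fun (u : R) _ => is_derive_cos u)
  (fun u : R => (@continuous_subspaceT _ _ _ _ (@continuous_cos R) u)).
by rewrite normrM normrN ler_piMl // ler_norml sin_geN1 sin_le1.
Qed.

Let om : R := pi *+ 2.
Definition expi (t : R) : C := Complex (cos (om * t)) (sin (om * t)).

Let om0 : 0 < om. Proof. by rewrite /om mulrn_wgt0 // pi_gt0. Qed.

Lemma cmod_expi t : cmod (expi t) = 1.
Proof.
by apply/eqP; rewrite -(@eqrXn2 _ 2) ?cmod_ge0 // sqr_cmod /cmod2 /= cos2Dsin2 expr1n.
Qed.

Lemma expi_neq0 t : expi t != 0.
Proof. by rewrite -cmod_gt0 cmod_expi. Qed.

Lemma expi01 : expi 1 = expi 0.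
Proof. by rewrite /expi mulr1 mulr0 cos2pi sin2pi cos0 sin0. Qed.

Lemma expi_lip s t : cmod (expi s - expi t) <= 2 * om * `|s - t|.
Proof.
have -> : expi s - expi t =
    rc (cos (om * s) - cos (om * t)) + 'i%C * rc (sin (om * s) - sin (om * t)).
  by apply/eqP; rewrite eq_complex /=; apply/andP; split; apply/eqP; ring.
apply: le_trans (cmodD _ _) _; rewrite cmodM !cmod_rc.
have -> : cmod ('i%C : C) = 1.
  apply/eqP; rewrite -(@eqrXn2 _ 2) ?cmod_ge0 // sqr_cmod /cmod2 /=.
  by apply/eqP; ring.
have := sin_lip (om * s) (om * t); have := cos_lip (om * s) (om * t).
rewrite -mulrBr normrM (gtr0_norm om0); lra.
Qed.

Let wind_edge (s t : R) : C :=
  ((expi s)^-1 + (expi t)^-1) * (expi t - expi s).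

Lemma wind_edgeE s t : wind_edge s t = Complex 0 (2 * sin (om * (t - s))).
Proof.
have inv u : (expi u)^-1 = conjc (expi u).
  apply: (mulfI (expi_neq0 u)); rewrite mulfV ?expi_neq0 //.
  apply/eqP; rewrite eq_complex /=; apply/andP; split; apply/eqP; last by lra.
  by have := cos2Dsin2 (om * u); lra.
rewrite /wind_edge !inv /expi [om * (t - s)]mulrBr sinB; apply/eqP; rewrite eq_complex /=.
apply/andP; split; apply/eqP; last by ring.
have := cos2Dsin2 (om * s); have := cos2Dsin2 (om * t).
by move=> H1 H2; lra.
Qed.

(** The sums of dz/z over the unit circle are 2^n times 2i sin(2 pi / 2^n). By
    the duplication formula these increase with n in modulus, which keeps them
    away from 0. *)
Lemma Im_dsum_wind n a b : 0 <= b - a -> b - a <= 4^-1 ->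
  2 * sin (om * (b - a)) <= complex.Im (dsum wind_edge n a b).
Proof.
elim: n a b => [|n IH] a b ab0 ab4; first by rewrite dsum0 wind_edgeE.
rewrite dsumS.
have E1 : mid a b - a = (b - a) / 2 by rewrite /mid; lra.
have E2 : b - mid a b = (b - a) / 2 by rewrite /mid; lra.
have := IH a (mid a b); rewrite E1 => /(_ ltac:(lra) ltac:(lra)).
have := IH (mid a b) b; rewrite E2 => /(_ ltac:(lra) ltac:(lra)).
move=> H1 H2.
have -> : om * (b - a) = (om * ((b - a) / 2)) *+ 2 by rewrite mulr2n; lra.
rewrite sin_mulr2n.
have -> (x y : C) : complex.Im (x + y) = complex.Im x + complex.Im y.
  by case: x y => [? ?] [].
have := cos_le1 (om * ((b - a) / 2)).
have : 0 <= sin (om * ((b - a) / 2)).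
  apply: sin_ge0_pi; apply/andP; split; first by apply: mulr_ge0; [exact: ltW|lra].
  rewrite /om; have := pi_gt0 R => p0; rewrite -mulr_natl; nra.
move: H1 H2; move: (sin _) (cos _) => S c; nra.
Qed.

Lemma Im_dsum_wind01 n : 8 <= complex.Im (dsum wind_edge n.+2 0 1).
Proof.
have Q a b : b - a = 4^-1 -> 2 <= complex.Im (dsum wind_edge n a b).
  move=> ab; have := @Im_dsum_wind n a b; rewrite ab => /(_ ltac:(lra) ltac:(lra)).
  have -> : om * 4^-1 = pi / 2 by rewrite /om -mulr_natl; lra.
  by rewrite sin_pihalf mulr1.
have ImD (x y : C) : complex.Im (x + y) = complex.Im x + complex.Im y.
  by case: x y => [? ?] [].
rewrite !dsumS !ImD.
have := Q 0 (mid 0 (mid 0 1)); have := Q (mid 0 (mid 0 1)) (mid 0 1).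
have := Q (mid 0 1) (mid (mid 0 1) 1); have := Q (mid (mid 0 1) 1) 1.
rewrite /mid => H1 H2 H3 H4.
have {}H1 := H1 ltac:(lra). have {}H2 := H2 ltac:(lra).
have {}H3 := H3 ltac:(lra). have {}H4 := H4 ltac:(lra).
by lra.
Qed.

Let circ_sum f (rho : R) n :=
  dsum (fun s t => trap (fun z => f z / z) (rc rho * expi s) (rc rho * expi t)) n 0 1.

Lemma trap_circ f (rho : R) s t : rho != 0 ->
  trap (fun z => f z / z) (rc rho * expi s) (rc rho * expi t) =
  (f (rc rho * expi s) / expi s + f (rc rho * expi t) / expi t) *
    (expi t - expi s).
Proof.
move=> r0; rewrite /trap.
have rC : rc rho != 0 by rewrite -cmod_gt0 cmod_rc normr_gt0.
by field; rewrite rC !expi_neq0.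
Qed.

Lemma circ_edge_le (u v : C) s t (M : R) : s <= t -> cmod u <= M -> cmod v <= M ->
  cmod ((u / expi s + v / expi t) * (expi t - expi s)) <= 4 * om * M * (t - s).
Proof.
move=> st uM vM; rewrite cmodM.
have -> : 4 * om * M * (t - s) = (M + M) * (2 * om * (t - s)) by ring.
apply: ler_pM; rewrite ?cmod_ge0 //.
  by apply: le_trans (cmodD _ _) _; rewrite !cmodM !cmodV !cmod_expi invr1 !mulr1 lerD.
have := expi_lip t s; rewrite ger0_norm //; lra.
Qed.

Lemma cmod_circ (rho : R) s : 0 <= rho -> cmod (rc rho * expi s) = rho.
Proof. by move=> r0; rewrite cmodM cmod_expi mulr1 cmod_rc ger0_norm. Qed.

(** Cauchy's theorem for f(z)/z on an annulus in polar coordinates: the two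
    straight sides cancel, so the sums over the outer circle are close to those
    over a small inner circle, which are nearly f(0) times the sums of dz/z. *)
Lemma centre_le_weak f (r M : R) : 0 < r ->
  (forall z, cmod z <= r -> differentiable f z) ->
  (forall z, cmod z = r -> cmod (f z) <= M) ->
  cmod (f 0) <= pi * M.
Proof.
move=> r0 df fM.
have M0 : 0 <= M.
  by apply: le_trans (cmod_ge0 _) (fM (rc r * expi 0) _); rewrite cmod_circ // ltW.
apply/ler_addgt0Pr => e e0.
have d0 : 0 < e / (om + 1) by rewrite divr_gt0 // ltr_wpDl // ltW.
have [d dp Hd] := cderiv_cont (differentiable_cderiv
   (df 0 ltac:(by rewrite cmod0; exact: ltW))) d0.
pose eps := Num.min (d / 2) (r / 2).
have eps0 : 0 < eps by rewrite lt_min !divr_gt0.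
have epsr : eps < r by rewrite gt_min; apply/orP; right; lra.
have epsd : eps < d by rewrite gt_min; apply/orP; left; lra.
pose P s t := rc (eps + s * (r - eps)) * expi t.
have rad s : 0 <= s <= 1 -> eps <= eps + s * (r - eps) <= r.
  move=> /andP[s0 s1].
  have : 0 <= s * (r - eps) by rewrite mulr_ge0 //; lra.
  have : 0 <= (1 - s) * (r - eps) by rewrite mulr_ge0 //; lra.
  by move=> *; apply/andP; split; lra.
have PL s t s' t' : 0 <= s <= 1 -> 0 <= t <= 1 -> 0 <= s' <= 1 ->
     0 <= t' <= 1 ->
     cmod (P s t - P s' t') <= (r + 2 * om * r) * (`|s - s'| + `|t - t'|).
  move=> hs ht hs' ht'; rewrite /P.
  have -> : rc (eps + s * (r - eps)) * expi t - rc (eps + s' * (r - eps)) * expi t' =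
      rc ((s - s') * (r - eps)) * expi t +
      rc (eps + s' * (r - eps)) * (expi t - expi t').
    by apply/eqP; rewrite eq_complex /=; apply/andP; split; apply/eqP; ring.
  apply: le_trans (cmodD _ _) _.
  rewrite !cmodM !cmod_rc cmod_expi mulr1 normrM.
  have /andP[a1 a2] := rad _ hs'.
  rewrite (ger0_norm (x := r - eps)); last by lra.
  rewrite (ger0_norm (x := eps + _)); last by lra.
  have L1 : `|s - s'| * (r - eps) <= r * `|s - s'|.
    by rewrite mulrC ler_wpM2r //; lra.
  have L2 : (eps + s' * (r - eps)) * cmod (expi t - expi t') <= r * (2 * om * `|t - t'|).
    by apply: ler_pM; rewrite ?cmod_ge0 ?expi_lip //; lra.
  have X1 : 0 <= r * `|t - t'| by rewrite mulr_ge0 // ltW.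
  have X2 : 0 <= 2 * om * r * `|s - s'| by rewrite !mulr_ge0 // ltW.
  by lra.
have Pd s t : 0 <= s <= 1 -> 0 <= t <= 1 -> cderiv_at (fun z => f z / z) (P s t).
  move=> hs ht; have /andP[a1 a2] := rad _ hs.
  apply: differentiable_cderiv.
  apply: (@differentiableM _ _ f (fun z => z^-1)).
    by apply: df; rewrite cmod_circ //; lra.
  apply: differentiable_Rinv.
  by rewrite -cmod_gt0 cmod_circ; lra.
have [N HN] := goursat PL Pd e0.
have := HN N.+2 (leqW (leqnSn N)); rewrite /cell_sum.
set H1 := (X in X + _ - _ - _); set H2 := (X in _ + _ - X - _).
have -> : H2 = H1 by rewrite /H1 /H2 /P expi01.
set V1 := (X in _ + X - _ - _); set V0 := (X in _ + _ - _ - X).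
have -> : H1 + V1 - H1 - V0 = V1 - V0 by ring.
have {H1 H2} -> : V1 = circ_sum f r N.+2.
  congr (dsum _ _ _ _); apply/funext => s; apply/funext => t.
  by rewrite /P; congr trap; congr (rc _ * _); ring.
have {V0} -> : V0 = circ_sum f eps N.+2.
  congr (dsum _ _ _ _); apply/funext => s; apply/funext => t.
  by rewrite /P; congr trap; congr (rc _ * _); ring.
have B1 : cmod (circ_sum f r N.+2) <= 4 * om * M.
  rewrite -[leRHS]mulr1 -[X in _ * X](subr0 1); apply: dsum_le; first exact: ler01.
  move=> s t _ st _; rewrite trap_circ ?gt_eqF //.
  by apply: circ_edge_le => //; apply: fM; rewrite cmod_circ // ltW.
have B2 : cmod (circ_sum f eps N.+2 - f 0 * dsum wind_edge N.+2 0 1) <=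
    4 * om * (e / (om + 1)).
  have -> : circ_sum f eps N.+2 - f 0 * dsum wind_edge N.+2 0 1 =
    dsum (fun s t => ((f (rc eps * expi s) - f 0) / expi s +
      (f (rc eps * expi t) - f 0) / expi t) * (expi t - expi s)) N.+2 0 1.
    rewrite -[f 0 * _]opprK -mulNr -dsumZ opprK -dsumD.
    congr (dsum _ _ _ _); apply/funext => s; apply/funext => t.
    by rewrite trap_circ ?gt_eqF // /wind_edge; ring.
  rewrite -[leRHS]mulr1 -[X in _ * X](subr0 1); apply: dsum_le; first exact: ler01.
  move=> s t _ st _.
  by apply: circ_edge_le => //; apply: Hd; rewrite subr0 cmod_circ // ltW.
move=> B3.
have B4 : 8 * cmod (f 0) <= cmod (f 0 * dsum wind_edge N.+2 0 1).
  rewrite cmodM mulrC; apply: ler_wpM2l; first exact: cmod_ge0.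
  exact: le_trans (Im_dsum_wind01 N) (Im_le_cmod _).
have B5 := cmodBl (f 0 * dsum wind_edge N.+2 0 1) (circ_sum f eps N.+2).
rewrite cmodBC in B5.
have B6 := cmodBl (circ_sum f eps N.+2) (circ_sum f r N.+2).
rewrite cmodBC in B6.
have B7 : om * (e / (om + 1)) <= e.
  rewrite mulrA ler_pdivrMr; last by rewrite ltr_wpDl // ltW.
  by have := e0; lra.
have B8 : om = 2 * pi by rewrite /om mulr_natl.
by rewrite B8 in B1 B2 B7 *; lra.
Qed.

Lemma differentiable_pow f z n :
  differentiable f z -> differentiable (fun w => f w ^+ n) z.
Proof.
move=> df; elim: n => [|n IH].
  by under eq_fun do rewrite expr0; exact: differentiable_cst.
by under eq_fun do rewrite exprS; exact: differentiableM.
Qed.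

(** The factor pi of the weak estimate disappears when that estimate is applied
    to the powers of f. *)
Theorem centre_le f (r M : R) : 0 < r ->
  (forall z, cmod z <= r -> differentiable f z) ->
  (forall z, cmod z = r -> cmod (f z) <= M) ->
  cmod (f 0) <= M.
Proof.
move=> r0 df fM.
have M0 : 0 <= M.
  by apply: le_trans (cmod_ge0 _) (fM (rc r * expi 0) _); rewrite cmod_circ // ltW.
apply: (@expr_le_bound _ _ pi) => // [|k]; first exact: cmod_ge0.
rewrite -cmodX; apply: (@centre_le_weak (fun z => f z ^+ k) r) => //.
  by move=> z zr; apply: differentiable_pow; exact: df.
by move=> z zr; rewrite cmodX lerXn2r ?nnegrE ?cmod_ge0 //; exact: fM.
Qed.

End Centre.

(** * The Schwarz lemma *)

Section Schwarz.
Context {R : realType}.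
Local Notation C := R[i].
Implicit Types (f G : C -> C) (z w u p : C).

Lemma differentiable_div f G z : differentiable f z -> differentiable G z ->
  G z != 0 -> differentiable (fun w => f w / G w) z.
Proof.
move=> df dG G0; exact: (differentiableM df (differentiableV dG G0)).
Qed.

Lemma differentiable_compC f G z : differentiable f z ->
  differentiable G (f z) -> differentiable (fun w => G (f w)) z.
Proof. by move=> df dG; exact: (differentiable_comp df dG). Qed.

Definition mob w u : C := (u + w) / (1 + conjc w * u).

Lemma cmod2_mob w u :
  cmod2 (1 + conjc w * u) = cmod2 (u + w) + (1 - cmod2 w) * (1 - cmod2 u).
Proof. by case: w u => [a b] [c d]; rewrite /cmod2 /=; ring. Qed.

Lemma cmod_lt1 z : (cmod z < 1) = (cmod2 z < 1).
Proof. by rewrite cmod_lt // expr1n. Qed.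

Lemma mob_den w u : cmod w < 1 -> cmod u < 1 -> 1 + conjc w * u != 0.
Proof.
rewrite !cmod_lt1 => w1 u1; rewrite -cmod2_gt0 cmod2_mob.
by rewrite ltr_wpDl ?cmod2_ge0 // mulr_gt0 // subr_gt0.
Qed.

Lemma mob_disk w u : cmod w < 1 -> cmod u < 1 -> cmod (mob w u) < 1.
Proof.
move=> w1 u1; have := mob_den w1 u1; rewrite -cmod2_gt0 => d0.
rewrite cmod_lt1 /mob cmod2M cmod2V ltr_pdivrMr // mul1r cmod2_mob ltrDl.
by rewrite mulr_gt0 // subr_gt0 -cmod_lt1.
Qed.

Lemma mobK w z : cmod w < 1 -> cmod z < 1 -> mob w (mob (- w) z) = z.
Proof.
move=> w1 z1; rewrite /mob.
have w1' : cmod (- w) < 1 by rewrite cmodN.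
have CN : conjc (- w) = - conjc w by case: (w) => a b.
have H1 := mob_den w1' z1; have H2 := mob_den w1' w1.
rewrite !CN !mulNr in H1 H2 *.
field; rewrite H1 /=.
by apply/eqP => H; move/eqP: H2; apply; rewrite -[RHS]H; ring.
Qed.

Lemma differentiable_mob w z : cmod w < 1 -> cmod z < 1 ->
  differentiable (mob w) z.
Proof.
move=> w1 z1; apply: differentiable_div; last exact: mob_den.
- by apply: differentiableD => //; exact: differentiable_cst.
- apply: differentiableD; first exact: differentiable_cst.
  by apply: differentiableM => //; exact: differentiable_cst.
Qed.

Lemma cvg_pow (F : set_system C) (q : C -> C) (l : C) k : Filter F ->
  q @ F --> l -> (fun h => q h ^+ k) @ F --> l ^+ k.
Proof.
move=> FF ql.
have dX : differentiable (fun w : C => w ^+ k) l.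
  by apply: (@differentiable_pow _ id); exact: ex_diff.
have cX := differentiable_continuous dX.
exact: (@cvg_comp _ _ _ q (fun w : C => w ^+ k) F (nbhs l) (nbhs (l ^+ k)) ql cX).
Qed.

(** The quotient f(z)/z need not be known to be differentiable at 0, but
    z (f(z)/z)^k is. *)
Lemma differentiable_quot_pow f k : differentiable f 0 -> f 0 = 0 ->
  differentiable (fun z => z * (f z / z) ^+ k) 0.
Proof.
move=> /derivable1_diffP df f0; apply/derivable1_diffP.
have [l dl] : exists l : C, (fun h : C => h^-1 *: ((f \o shift 0) (h *: 1) - f 0)) @ 0^' --> l.
  by exists (lim ((fun h : C => h^-1 *: ((f \o shift 0) (h *: 1) - f 0)) @ 0^')).
have FF : Filter (0^' : set_system C) by typeclasses eauto.
have dk := @cvg_pow _ _ _ k FF dl.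
rewrite /derivable; apply/cvg_ex; exists (l ^+ k).
apply: cvg_trans dk; apply: near_eq_cvg; near=> h.
have h0 : h != 0 by near: h; exact: nbhs_dnbhs_neq.
rewrite /= f0 mul0r !subr0 !addr0 -[h *: 1]/(h * 1) !mulr1.
rewrite -![_ *: _]/(_ * _) mulrA mulVf // mul1r mulrC //.
Unshelve. all: by end_near. Qed.

(** The estimate at the centre is applied to z (f(z)/z)^k precomposed with the
    automorphism of the disk that takes 0 to p. As k grows the factor z loses
    its influence, and as the radius tends to 1 so does the modulus of the
    automorphism on the circle. *)
Lemma schwarz f p :
  (forall z, cmod z < 1 -> differentiable f z) ->
  (forall z, cmod z < 1 -> cmod (f z) <= 1) -> f 0 = 0 ->
  cmod p < 1 -> cmod (f p) <= cmod p.
Proof.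
move=> df f1 f0 p1.
have [->|p0] := eqVneq p 0; first by rewrite f0.
have pp : 0 < cmod p by rewrite cmod_gt0.
suff H (eta : R) : 0 < eta -> eta < 1 -> cmod (f p) * eta <= cmod p.
  rewrite leNgt; apply/negP => lt.
  have fp : 0 < cmod (f p) by exact: lt_trans lt.
  pose eta := (cmod p / cmod (f p) + 1) / 2.
  have q1 : cmod p / cmod (f p) < 1 by rewrite ltr_pdivrMr // mul1r.
  have q0 : 0 < cmod p / cmod (f p) by rewrite divr_gt0.
  have := H eta; rewrite /eta => /(_ ltac:(lra) ltac:(lra)).
  rewrite mulrA mulrDr mulr1 mulrCA divff ?gt_eqF // mulr1.
  by lra.
move=> eta0 eta1.
(* on the circle of radius r the automorphism taking 0 to p has modulus at
   least eta *)
pose r := 1 - (1 - eta) * (1 - cmod p) / 4.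
have X0 : 0 < (1 - eta) * (1 - cmod p) by rewrite mulr_gt0 // subr_gt0.
have X1 : (1 - eta) * (1 - cmod p) < 1.
  have : (1 - eta) * (1 - cmod p) <= (1 - eta) * 1 by rewrite ler_wpM2l //; lra.
  by lra.
have r0 : 0 < r by rewrite /r; lra.
have r1 : r < 1 by rewrite /r; lra.
have far z : cmod z = r -> eta <= cmod (mob p z).
  move=> zr; have z1 : cmod z < 1 by rewrite zr.
  have mob1 := mob_disk p1 z1.
  have : eta <= cmod (mob p z) ^+ 2.
    have D := mob_den p1 z1; rewrite -cmod2_gt0 in D.
    rewrite sqr_cmod /mob cmod2M cmod2V ler_pdivlMr //.
    have E := cmod2_mob p z.
    have : (1 - cmod p) ^+ 2 <= cmod2 (1 + conjc p * z).
      rewrite -sqr_cmod ler_sqr ?nnegrE ?cmod_ge0 //; last by rewrite subr_ge0 ltW.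
      have := cmodBl 1 (- (conjc p * z)); rewrite opprK cmodN cmodM cmod_conj cmod1.
      have : cmod p * cmod z <= cmod p * 1 by rewrite ler_wpM2l ?cmod_ge0 // ltW.
      by lra.
    move: E; rewrite -!sqr_cmod zr.
    set D' := cmod (1 + _) ^+ 2; set N' := cmod (z + p) ^+ 2 => E LB.
    have A1 : (1 - eta) * (1 - cmod p) ^+ 2 <= (1 - eta) * D'.
      by rewrite ler_wpM2l //; lra.
    suff : (1 - cmod p ^+ 2) * (1 - r ^+ 2) <= (1 - eta) * (1 - cmod p) ^+ 2.
      by lra.
    have A2 : 1 - r ^+ 2 <= 2 * (1 - r).
      have : 0 <= (1 - r) ^+ 2 by exact: sqr_ge0.
      by lra.
    have A3 : 1 - cmod p ^+ 2 <= 2 * (1 - cmod p).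
      have : 0 <= (1 - cmod p) ^+ 2 by exact: sqr_ge0.
      by lra.
    apply: le_trans (ler_pM _ _ A3 A2) _.
    + by rewrite subr_ge0 -(expr1n _ 2) lerXn2r ?nnegrE ?cmod_ge0 ?ltW.
    + by rewrite subr_ge0 -(expr1n _ 2) lerXn2r ?nnegrE ?ltW.
    + by rewrite /r; lra.
  move=> H; apply: le_trans H _.
  by rewrite expr2 ler_piMl ?cmod_ge0 // ltW.
have K k : (cmod (f p) / cmod p) ^+ k <= (cmod p)^-1 * (eta^-1) ^+ k.
  case: k => [|k]; first by rewrite !expr0 mulr1 invf_ge1 // ltW.
  pose h z := z * (f z / z) ^+ k.+1.
  have mp0 : mob p 0 = p by rewrite /mob add0r mulr0 addr0 divr1.
  have := @centre_le R (fun z => h (mob p z)) r (eta^-1 ^+ k.+1) r0.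
  rewrite mp0 /h => CL; rewrite -[leRHS]mulrC ler_pdivlMr // mulrC; move: CL; rewrite cmodM cmodX cmodM cmodV; apply.
  - move=> z zr; have z1 : cmod z < 1 by exact: le_lt_trans zr r1.
    apply: (@differentiable_compC (mob p) h); first exact: differentiable_mob.
    have m1 := mob_disk p1 z1.
    have [-> |m0] := eqVneq (mob p z) 0.
      by apply: differentiable_quot_pow => //; apply: df; rewrite cmod0.
    apply: (@differentiableM _ _ id (fun w => (f w / w) ^+ k.+1)) => //.
    apply: differentiable_pow; apply: (@differentiable_div f id) => //.
    exact: df.
  - move=> z zr; have z1 : cmod z < 1 by rewrite zr.
    have m1 := mob_disk p1 z1; have me := far _ zr.
    have mpos : 0 < cmod (mob p z) by exact: lt_le_trans me.
    rewrite cmodM -[leRHS]mul1r; apply: ler_pM; rewrite ?cmod_ge0 //; first exact: ltW.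
    rewrite cmodX lerXn2r ?nnegrE ?cmod_ge0 ?invr_ge0 ?(ltW eta0) //.
    rewrite cmodM cmodV -[leRHS]mul1r; apply: ler_pM; rewrite ?cmod_ge0 ?invr_ge0 ?cmod_ge0 //.
      exact: f1.
    by rewrite lef_pV2 ?posrE.


have Q0 : 0 <= cmod (f p) / cmod p by rewrite divr_ge0 ?cmod_ge0.
have E0 : 0 <= eta^-1 by rewrite invr_ge0 ltW.
by have := expr_le_bound Q0 E0 K; rewrite ler_pdivrMr // mulrC ler_pdivlMr.
Qed.

(** The Schwarz lemma, conjugated by the automorphisms of the disk that move w
    and f(w) to 0. *)
Lemma schwarz_pick f z w :
  (forall z, cmod z < 1 -> differentiable f z) ->
  (forall z, cmod z < 1 -> cmod (f z) < 1) ->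
  cmod z < 1 -> cmod w < 1 ->
  cmod2 (1 - conjc (f w) * f z) * ((1 - cmod2 z) * (1 - cmod2 w)) <=
  cmod2 (1 - conjc w * z) * ((1 - cmod2 (f z)) * (1 - cmod2 (f w))).
Proof.
move=> df f1 z1 w1.
have w1' : cmod (- w) < 1 by rewrite cmodN.
have fw1' : cmod (- f w) < 1 by rewrite cmodN; exact: f1.
have CN u : conjc (- u) = - conjc u by case: u => a b.
pose F u := mob (- f w) (f (mob w u)).
have := @schwarz F (mob (- w) z).
have F0 : F 0 = 0.
  by rewrite /F [mob w 0]/mob add0r mulr0 addr0 divr1 /mob subrr mul0r.
have dF u : cmod u < 1 -> differentiable F u.
  move=> u1; have m1 := mob_disk w1 u1.
  apply: (@differentiable_compC (fun u => f (mob w u)) (mob (- f w))).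
    apply: (@differentiable_compC (mob w) f); last exact: df.
    exact: differentiable_mob.
  by apply: differentiable_mob => //; exact: f1.
move=> /(_ dF)/(_ _ F0 (mob_disk w1' z1)).
have F1 u : cmod u < 1 -> cmod (F u) <= 1.
  by move=> u1; apply/ltW; apply: mob_disk => //; apply: f1; exact: mob_disk.
move=> /(_ F1); rewrite /F mobK //.
have D1 := mob_den w1' z1; have D2 := mob_den fw1' (f1 _ z1).
rewrite -!cmod2_gt0 in D1 D2.
rewrite -ler_sqr ?nnegrE ?cmod_ge0 // !sqr_cmod /mob !cmod2M !cmod2V.
rewrite ler_pdivrMr // mulrAC ler_pdivlMr //.
have E1 := cmod2_mob (- w) z; have E2 := cmod2_mob (- f w) (f z).
have N2 u : cmod2 (- u) = cmod2 u by rewrite -!sqr_cmod cmodN.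
rewrite !CN !mulNr !N2 in E1 E2 *.
move: E1 E2.
set a := cmod2 (1 - conjc w * z); set b := cmod2 (1 - conjc (f w) * f z).
set c := cmod2 (z - w); set d := cmod2 (f z - f w) => -> -> H.
set P := _ * (1 - cmod2 z) in H *; set Q := _ * (1 - cmod2 (f z)) in H *.
rewrite [_ * (1 - cmod2 w)]mulrC [_ * (1 - cmod2 (f w))]mulrC -/P -/Q.
by lra.
Qed.

Lemma cmod2_addconj (a b : C) :
  cmod2 (a + conjc b) = cmod2 (a - b) + 4 * (complex.Re a * complex.Re b).
Proof. by case: a b => [a a'] [b b']; rewrite /cmod2 /=; ring. Qed.

(** The Schwarz lemma for (G - G(0)) / (G + conj G(0)). *)
Let strict_pick G (x : R) :
  (forall z, cmod z < 1 -> differentiable G z) ->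
  (forall z, cmod z < 1 -> 0 < complex.Re (G z)) -> 0 <= x < 1 ->
  cmod2 (G (rc x) + conjc (G 0)) * (1 - x ^+ 2) <=
    4 * (complex.Re (G 0) * complex.Re (G (rc x))).
Proof.
move=> dG G0 /andP[x0 x1].
have z0 : cmod (0 : C) < 1 by rewrite cmod0.
have zx : cmod (rc x) < 1 by rewrite cmod_rc ger0_norm.
have A0 := G0 _ z0.
have den z : cmod z < 1 -> 0 < cmod2 (G z + conjc (G 0)).
  move=> z1; rewrite cmod2_addconj ltr_wpDl ?cmod2_ge0 //.
  by rewrite mulr_gt0 // mulr_gt0 // G0.
pose f z := (G z - G 0) / (G z + conjc (G 0)).
have df z : cmod z < 1 -> differentiable f z.
  move=> z1; apply: differentiable_div.
  - by apply: differentiableB; [exact: dG|exact: differentiable_cst].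
  - by apply: differentiableD; [exact: dG|exact: differentiable_cst].
  - by rewrite -cmod2_gt0 den.
have f1 z : cmod z < 1 -> cmod (f z) <= 1.
  move=> z1; rewrite cmod_le // expr1n /f cmod2M cmod2V ler_pdivrMr ?den //.
  rewrite mul1r cmod2_addconj lerDl mulr_ge0 // mulr_ge0 // ltW //.
  exact: G0.
have f0 : f 0 = 0 by rewrite /f subrr mul0r.
have := schwarz df f1 f0 zx.
rewrite cmod_rc ger0_norm // cmod_le // /f cmod2M cmod2V ler_pdivrMr ?den //.
rewrite cmod2_addconj [complex.Re (G 0) * _]mulrC; lra.
Qed.

(** The Schwarz lemma for functions with nonnegative real part; it is a sharp
    form of Harnack's inequality. *)
Lemma positive_pick G (x : R) :
  (forall z, cmod z < 1 -> differentiable G z) ->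
  (forall z, cmod z < 1 -> 0 <= complex.Re (G z)) -> 0 <= x < 1 ->
  cmod2 (G (rc x) + conjc (G 0)) * (1 - x ^+ 2) <=
    4 * (complex.Re (G 0) * complex.Re (G (rc x))).
Proof.
move=> dG G0 x01; have /andP[x0 x1] := x01.
have a0 := G0 0 ltac:(by rewrite cmod0).
have b0 := G0 (rc x) ltac:(by rewrite cmod_rc ger0_norm).
apply/ler_addgt0Pr => e e0.
pose a := complex.Re (G 0); pose b := complex.Re (G (rc x)).
rewrite -/a -/b in a0 b0 *.
(* G + d has positive real part; the condition on d bounds the increase of the
   right-hand side by e *)
pose d := Num.min 1 (e / (4 * (a + b + 1))).
have k0 : 0 < 4 * (a + b + 1) by lra.
have d0 : 0 < d by rewrite lt_min ltr01 divr_gt0.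
have d1 : d <= 1 by rewrite ge_min lexx.
have de : d * (4 * (a + b + 1)) <= e.
  by rewrite -ler_pdivlMr // ge_min lexx orbT.
have := @strict_pick (fun z => G z + rc d) x; cbv beta.
have -> : G (rc x) + rc d + conjc (G 0 + rc d) = G (rc x) + conjc (G 0) + rc (2 * d).
  by apply/eqP; rewrite eq_complex; case: (G 0) (G (rc x)) => [u v] [u1 v1] /=; apply/andP; split; apply/eqP; ring.
rewrite !ReD !Re_rc -/a -/b => H.
have {}H : cmod2 (G (rc x) + conjc (G 0) + rc (2 * d)) * (1 - x ^+ 2) <=
    4 * ((a + d) * (b + d)).
  apply: H; last exact: x01.
    by move=> z z1; apply: differentiableD; [exact: dG|exact: differentiable_cst].
  by move=> z z1; rewrite ReD Re_rc; have := G0 z z1; lra.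
have M : cmod2 (G (rc x) + conjc (G 0)) <= cmod2 (G (rc x) + conjc (G 0) + rc (2 * d)).
  have : 0 <= complex.Re (G (rc x) + conjc (G 0)) by rewrite ReD Re_conjc addr_ge0.
  case: (G (rc x) + conjc (G 0)) => u v; rewrite /cmod2 /= => u0.
  have : 0 <= u * d by rewrite mulr_ge0 // ltW.
  have := sqr_ge0 d; lra.
have x2 : 0 <= 1 - x ^+ 2.
  by rewrite subr_ge0 -(expr1n _ 2) lerXn2r ?nnegrE // ltW.
have := ler_wpM2r x2 M.
have : d * d <= d * 1 by rewrite ler_wpM2l // ltW.
lra.
Qed.

End Schwarz.

Lemma differentiable_curve (R : realType) (a b : R[i] -> R[i])
    (h : R[i] * R[i] -> R[i]) (z : R[i]) :
  differentiable a z -> differentiable b z -> differentiable h (a z, b z) ->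
  differentiable (fun u => h (a u, b u)) z.
Proof.
by move=> da db dh; apply: differentiable_comp => //; exact: differentiable_pair.
Qed.

(** * Functions of nonnegative real part on a product of half planes *)

Section HalfPlanes.
Context {R : realType}.
Local Notation C := R[i].
Local Notation Re := complex.Re.
Variable g : C * C -> C.
Hypothesis gd : forall a b c d u : C, 0 < Re (a + u * c) -> 0 < Re (b + u * d) ->
  differentiable (fun v : C => g (a + v * c, b + v * d)) u.
Hypothesis gp : forall a b : C, 0 < Re a -> 0 < Re b -> 0 <= Re (g (a, b)).

Lemma rcB (x y : R) : rc (x - y) = rc x - rc y.
Proof. by apply/eqP; rewrite eq_complex /= subr0 !eqxx. Qed.

(** Restriction to the complex line through two points, to a disk centred
    at the first. *)
Lemma pick_line (a1 a2 d1 d2 : C) (x : R) : 0 < x < 1 ->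
  0 < Re a1 -> 0 < Re a2 -> cmod d1 <= x * Re a1 -> cmod d2 <= x * Re a2 ->
  cmod2 (g (a1 + d1, a2 + d2) + conjc (g (a1, a2))) * (1 - x ^+ 2) <=
    4 * (Re (g (a1, a2)) * Re (g (a1 + d1, a2 + d2))).
Proof.
move=> /andP[x0 x1] p1 p2 D1 D2.
have inside (a d u : C) : 0 < Re a -> cmod d <= x * Re a -> cmod u < 1 ->
    0 < Re (a + u * (d / rc x)).
  move=> a0 da u1; rewrite ReD.
  have : cmod (u * (d / rc x)) < Re a.
    rewrite !cmodM cmodV cmod_rc (gtr0_norm x0).
    have q : cmod d / x <= Re a by rewrite ler_pdivrMr // mulrC.
    have q0 : 0 <= cmod d / x by rewrite divr_ge0 ?cmod_ge0 // ltW.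
    have : cmod u * (cmod d / x) <= cmod u * Re a by rewrite ler_wpM2l ?cmod_ge0.
    have : cmod u * Re a < 1 * Re a by rewrite ltr_pM2r.
    by lra.
  by have := Re_ge_Ncmod (u * (d / rc x)); lra.
pose G u := g (a1 + u * (d1 / rc x), a2 + u * (d2 / rc x)).
have rx : rc x != 0 by rewrite -cmod_gt0 cmod_rc normr_gt0 gt_eqF.
have -> : g (a1 + d1, a2 + d2) = G (rc x).
  by rewrite /G; congr g; congr pair; rewrite mulrCA divff // mulr1.
have -> : g (a1, a2) = G 0 by rewrite /G !mul0r !addr0.
apply: positive_pick; last by rewrite ltW.
- by move=> u u1; apply: gd; exact: inside.
- by move=> u u1; apply: gp; exact: inside.
Qed.

(** Only the order of magnitude matters in what follows, so the constants are
    not the best ones. *)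
Lemma harnack_line (a1 a2 d1 d2 : C) (x : R) : 0 < x < 1 ->
  0 < Re a1 -> 0 < Re a2 -> cmod d1 <= x * Re a1 -> cmod d2 <= x * Re a2 ->
  (1 - x ^+ 2) * Re (g (a1, a2)) <= 4 * Re (g (a1 + d1, a2 + d2)) /\
  (1 - x ^+ 2) * cmod (g (a1 + d1, a2 + d2)) <= 5 * cmod (g (a1, a2)).
Proof.
move=> x01 p1 p2 D1 D2; have := pick_line x01 p1 p2 D1 D2.
have /andP[x0 x1] := x01.
have x2 : 0 < 1 - x ^+ 2 by rewrite subr_gt0 -(expr1n _ 2) ltrXn2r // ltW.
have x21 : 1 - x ^+ 2 <= 1 by rewrite gerBl sqr_ge0.
have q1 : 0 < Re (a1 + d1).
  rewrite ReD; have := Re_ge_Ncmod d1.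
  have : x * Re a1 < 1 * Re a1 by rewrite ltr_pM2r.
  by lra.
have q2 : 0 < Re (a2 + d2).
  rewrite ReD; have := Re_ge_Ncmod d2.
  have : x * Re a2 < 1 * Re a2 by rewrite ltr_pM2r.
  by lra.
have := gp p1 p2; have := gp q1 q2.
set A := g (a1, a2); set B := g (a1 + d1, a2 + d2).
rewrite -sqr_cmod; set y := cmod (B + conjc A) => b0 a0 H.
have yab : Re A + Re B <= y.
  by have := Re_le_cmod (B + conjc A); rewrite ReD Re_conjc addrC.
have [y0|yn] := ltP 0 y; last first.
  have [A0 B0] : Re A = 0 /\ Re B = 0 by split; lra.
  rewrite A0 B0 !mulr0; split=> //.
  have : cmod B <= cmod A.
    have -> : B = (B + conjc A) - conjc A by ring.
    by apply: le_trans (cmodB _ _) _; rewrite cmod_conj -/y; lra.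
  have := cmod_ge0 A; have := cmod_ge0 B; nra.
have K1 : y * (1 - x ^+ 2) <= 4 * Re B.
  rewrite -(ler_pM2l y0); apply: le_trans (_ : 4 * (Re A * Re B) <= _).
    by have := H; lra.
  have : Re A * Re B <= y * Re B by rewrite ler_wpM2r //; lra.
  by lra.
have K2 : y * (1 - x ^+ 2) <= 4 * Re A.
  rewrite -(ler_pM2l y0); apply: le_trans (_ : 4 * (Re A * Re B) <= _).
    by have := H; lra.
  have : Re A * Re B <= Re A * y by rewrite ler_wpM2l //; lra.
  by lra.
split.
  by apply: le_trans K1; rewrite mulrC; apply: ler_wpM2r; [exact: ltW|lra].
have BA : cmod B <= y + cmod A.
  have {1}-> : B = (B + conjc A) - conjc A by ring.
  by apply: le_trans (cmodB _ _) _; rewrite cmod_conj.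
have := Re_le_cmod A; have := cmod_ge0 A.
have : (1 - x ^+ 2) * cmod B <= (1 - x ^+ 2) * (y + cmod A) by rewrite ler_wpM2l // ltW.
have : (1 - x ^+ 2) * cmod A <= 1 * cmod A by rewrite ler_wpM2r ?cmod_ge0.
by lra.
Qed.

Let diag (t : R) := g (rc t, rc t).

(** A linear lower bound on the diagonal spreads to the whole domain: both
    points are compared with a far point of the ray through (zeta, omega)
    in the direction (1, 1). *)
Lemma diag_growth (k m : R) (z w : C) : 0 < k ->
  (forall t : R, 0 < t -> k * t <= Re (diag t)) ->
  0 < m -> m <= Re z -> m <= Re w -> k * m / 32 <= Re (g (z, w)).
Proof.
move=> k0 H m0 mz mw.
(* t is so large that z - m and w - m have modulus at most t m / 2 *)
pose t := 2 + 2 * (cmod (z - rc m) + cmod (w - rc m)) / m.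
have t1 : 2 <= t.
  rewrite lerDl; apply: divr_ge0; last exact: ltW.
  by apply: mulr_ge0 => //; apply: addr_ge0; exact: cmod_ge0.
have tm : 2 * (cmod (z - rc m) + cmod (w - rc m)) <= t * m.
  have -> : t * m = 2 * m + 2 * (cmod (z - rc m) + cmod (w - rc m)).
    by rewrite /t; field; rewrite gt_eqF.
  by lra.
have t0 : 0 < t by lra.
have m0' : 0 < t * m by rewrite mulr_gt0.
have cz := cmod_ge0 (z - rc m); have cw := cmod_ge0 (w - rc m).
pose a1 := rc (t * m) + (z - rc m); pose a2 := rc (t * m) + (w - rc m).
have far : 3 / 16 * (k * (t * m)) <= Re (g (a1, a2)).
  have [] := @harnack_line (rc (t * m)) (rc (t * m)) (z - rc m) (w - rc m) (2^-1);
    rewrite ?Re_rc //; try lra.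
  have := H _ m0'; rewrite /diag -/a1 -/a2; lra.
have Ra1 : t * m <= Re a1.
  by rewrite /a1 !ReD ReN !Re_rc; lra.
have Ra2 : t * m <= Re a2.
  by rewrite /a2 !ReD ReN !Re_rc; lra.
pose x := 1 - t^-1.
have ti : 0 < t^-1 by rewrite invr_gt0.
have tt : t^-1 * t = 1 by rewrite mulVf // gt_eqF.
have ti2 : t^-1 <= 2^-1 by rewrite lef_pV2 ?posrE.
pose d := rc (m - t * m).
have xt : x * t = t - 1 by rewrite /x mulrBl tt mul1r.
have dle (a : R) : t * m <= a -> cmod d <= x * a.
  move=> ta; rewrite cmod_rc ler0_norm; last by nra.
  have : x * (t * m) <= x * a by rewrite ler_wpM2l // /x; lra.
  by rewrite mulrA xt; lra.
have -> : (z, w) = (a1 + d, a2 + d).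
  by rewrite /a1 /a2 /d rcB; congr pair; ring.
have [] := @harnack_line a1 a2 d d x; rewrite ?dle //; rewrite /x; try lra.
set B := Re (g (a1 + d, a2 + d)) => H1 _.
have e1 : t^-1 <= 1 - (1 - t^-1) ^+ 2.
  have : t^-1 * t^-1 <= t^-1 * 2^-1 by rewrite ler_pM2l.
  by lra.
have A0 : 0 <= Re (g (a1, a2)) by apply: gp; lra.
have : t^-1 * (3 / 16 * (k * (t * m))) <= t^-1 * Re (g (a1, a2)) by rewrite ler_pM2l.
have : t^-1 * Re (g (a1, a2)) <= (1 - (1 - t^-1) ^+ 2) * Re (g (a1, a2)).
  by rewrite ler_wpM2r.
have -> : t^-1 * (3 / 16 * (k * (t * m))) = 3 / 16 * (k * m) * (t^-1 * t) by ring.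
rewrite tt; have : 0 < k * m by rewrite mulr_gt0.
by lra.
Qed.

(** By Harnack's inequality Re g(t,t) / t decreases up to a factor 4, so one
    small value makes all later ones small; comparison with g(1,1) then bounds
    the imaginary part as well. *)
Lemma diag_small : ~ (exists2 k : R, 0 < k & forall t : R, 0 < t -> k * t <= Re (diag t)) ->
  forall e : R, 0 < e -> exists T, forall t, T <= t -> cmod (diag t) <= e * t.
Proof.
move=> nk e e0.
pose b := Re (diag 1).
have b0 : 0 <= b by apply: gp; rewrite Re_rc.
pose k := (e / 2) ^+ 2 / (16 * (b + 1)).
have kp : 0 < 16 * (b + 1) by lra.
have k0 : 0 < k by rewrite divr_gt0 // exprn_gt0 // divr_gt0.
have [t0 [t00 Ht0]] : exists t, 0 < t /\ Re (diag t) < k * t.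
  apply: contrapT => H; apply: nk; exists k => // t t0.
  by rewrite leNgt; apply/negP => lt; apply: H; exists t.
have lower (s t : R) : 0 < s -> s < t -> [/\ 0 < 1 - s / t < 1,
    s / t <= 1 - (1 - s / t) ^+ 2 & cmod (rc (s - t)) <= (1 - s / t) * t].
  move=> s0 st; have tp : 0 < t by exact: lt_trans st.
  have q0 : 0 < s / t by rewrite divr_gt0.
  have q1 : s / t < 1 by rewrite ltr_pdivrMr // mul1r.
  split; first by apply/andP; split; lra.
  - have : s / t * (s / t) <= s / t * 1 by rewrite ler_pM2l // ltW.
    by lra.
  - rewrite cmod_rc ltr0_norm; last by lra.
    by rewrite mulrBl divfK ?gt_eqF //; lra.
pose T := t0 + 1 + 2 * cmod (diag 1) / e.
have T0 : t0 + 1 <= T.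
  rewrite lerDl; apply: divr_ge0; last exact: ltW.
  by apply: mulr_ge0 => //; exact: cmod_ge0.
have Te : 2 * cmod (diag 1) <= e * T.
  have -> : e * T = e * (t0 + 1) + 2 * cmod (diag 1).
    by rewrite /T; field; rewrite gt_eqF.
  by rewrite lerDr mulr_ge0 //; lra.
exists T => t tT.
have tp : 0 < t by lra.
have Rt : Re (diag t) <= 4 * k * t.
  have [x01 x2 xd] := lower t0 t t00 ltac:(lra).
  have [] := @harnack_line (rc t) (rc t) (rc (t0 - t)) (rc (t0 - t)) _ x01;
    rewrite ?Re_rc //.
  have -> : rc t + rc (t0 - t) = rc t0.
    by rewrite rcB; ring.
  rewrite -/(diag t) -/(diag t0) => H _.
  have dt : 0 <= Re (diag t) by apply: gp; rewrite Re_rc.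
  have : t0 / t * Re (diag t) <= 4 * (k * t0).
    apply: le_trans (ler_wpM2r dt x2) _; lra.
  rewrite mulrAC ler_pdivrMr // => H2.
  rewrite -(ler_pM2l t00); lra.
have [x01 x2 xd] := lower 1 t ltr01 ltac:(lra).
have := @pick_line (rc t) (rc t) (rc (1 - t)) (rc (1 - t)) _ x01.
rewrite !Re_rc => /(_ tp tp xd xd).
have -> : rc t + rc (1 - t) = rc 1.
  by rewrite rcB; ring.
rewrite -/(diag t) -/(diag 1) -/b => H.
have c2 : 0 <= cmod2 (diag 1 + conjc (diag t)) by exact: cmod2_ge0.
have H2 : cmod2 (diag 1 + conjc (diag t)) * (1 / t) <= 4 * (4 * k * t * b).
  apply: le_trans (ler_wpM2l c2 x2) _; apply: le_trans H _.
  by rewrite ler_pM2l // ler_wpM2r.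
have H3 : cmod (diag 1 + conjc (diag t)) <= e / 2 * t.
  rewrite cmod_le; last by apply: mulr_ge0; apply/ltW => //; exact: divr_gt0.
  move: H2; rewrite mul1r ler_pdivrMr // => H2.
  apply: le_trans H2 _.
  have kb : k * (16 * (b + 1)) = (e / 2) ^+ 2 by rewrite /k divfK ?gt_eqF.
  rewrite exprMn -kb.
  have : 0 < k * t ^+ 2 by rewrite mulr_gt0 // exprn_gt0.
  lra.
rewrite -(cmod_conj (diag t)).
have -> : conjc (diag t) = (diag 1 + conjc (diag t)) - diag 1 by ring.
apply: le_trans (cmodB _ _) _.
have : e * T <= e * t by rewrite ler_pM2l.
by lra.
Qed.

(** The hypotheses on z and w hold when (z, w) comes from a point at distance d
    from (tau, sigma) in an approach region of aperture c. Such points stay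
    within a bounded hyperbolic distance of the diagonal. *)
Lemma nontangential_small (c : R) : 1 <= c ->
  ~ (exists2 k : R, 0 < k & forall t : R, 0 < t -> k * t <= Re (diag t)) ->
  forall e : R, 0 < e -> exists2 d0, 0 < d0 & forall (d : R) (z w : C),
    0 < d -> d < d0 ->
    (c * d)^-1 <= Re z -> (c * d)^-1 <= Re w ->
    cmod z <= 3 * c / d -> cmod w <= 3 * c / d ->
    cmod (g (z, w)) <= e / d.
Proof.
move=> c1 nk e e0.
have c0 : 0 < c by lra.
have c4 : 1 <= c ^+ 4 by rewrite exprn_ege1.
pose q := (9 * c ^+ 4)^-1.
have q0 : 0 < q by rewrite invr_gt0; lra.
have qc : q * (9 * c ^+ 4) = 1 by rewrite mulVf // gt_eqF //; lra.
have q1 : q < 1 by rewrite invf_lt1; lra.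
(* for t = 9 c^3 / d the bounds on Re z and |z| give |z - t|^2 <= (1 - q) t^2 *)
pose x := Num.sqrt (1 - q).
have x2 : x ^+ 2 = 1 - q by rewrite sqr_sqrtr //; lra.
have x01 : 0 < x < 1.
  rewrite sqrtr_gt0 subr_gt0 q1 /= -(ltr_sqr _ _) ?nnegrE ?sqrtr_ge0 //.
  by rewrite x2 expr1n; lra.
have e'0 : 0 < e * q / (5 * 9 * c ^+ 3).
  by rewrite divr_gt0 ?mulr_gt0 // exprn_gt0.
have [T HT] := diag_small nk e'0.
pose T' := Num.max T 1.
exists (9 * c ^+ 3 / T').
  rewrite divr_gt0 ?mulr_gt0 ?exprn_gt0 //.
  by rewrite lt_max ltr01 orbT.
move=> d z w d0 dd Rz Rw mz mw.
pose t := 9 * c ^+ 3 / d.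
have T'0 : 0 < T' by rewrite lt_max ltr01 orbT.
have tT : T <= t.
  have : T' <= t.
    rewrite /t ler_pdivlMr // mulrC -ler_pdivlMr //; exact: ltW.
  by apply: le_trans; rewrite le_max lexx.
have t0 : 0 < t by rewrite divr_gt0 // mulr_gt0 // exprn_gt0.
have near (v : C) : (c * d)^-1 <= Re v -> cmod v <= 3 * c / d ->
    cmod (v - rc t) <= x * t.
  move=> Rv mv.
  have /andP[x0 _] := x01.
  rewrite cmod_le; last by apply: mulr_ge0; exact: ltW.
  rewrite exprMn x2.
  have v2 : cmod2 v <= (3 * c / d) ^+ 2.
    by rewrite -cmod_le // ltW // divr_gt0 // mulr_gt0.
  have -> : cmod2 (v - rc t) = cmod2 v - 2 * t * Re v + t ^+ 2.
    by case: (v) => u u'; rewrite /cmod2 /=; ring.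
  have A1 : (2 * t) * (c * d)^-1 <= 2 * t * Re v by rewrite ler_wpM2l //; lra.
  have A2 : (2 * t) * (c * d)^-1 = 2 * (3 * c / d) ^+ 2.
    by rewrite /t; field; rewrite !gt_eqF.
  have A3 : q * t ^+ 2 = (3 * c / d) ^+ 2.
    rewrite /t /q; field; rewrite !gt_eqF //.
  by lra.
have := @harnack_line (rc t) (rc t) (z - rc t) (w - rc t) x x01.
rewrite !Re_rc !(addrC (rc t)) !subrK => /(_ t0 t0 (near _ Rz mz) (near _ Rw mw)) [_].
have -> : 1 - x ^+ 2 = q by rewrite x2; ring.
rewrite -/(diag t) => H.
have := HT _ tT => H2.
rewrite -(ler_pM2l q0); apply: le_trans H _.
have -> : q * (e / d) = 5 * (e * q / (5 * 9 * c ^+ 3) * t).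
  by rewrite /t; field; rewrite !gt_eqF.
by rewrite ler_pM2l.
Qed.

End HalfPlanes.

(** * Cayley transform, horodisks and Wolff's lemma *)

Section Cayley.
Context {R : realType}.
Local Notation C := R[i].
Local Notation Re := complex.Re.
Implicit Types (t z w zeta : C).

Definition cay t z : C := (t + z) / (t - z).
Definition icay t zeta : C := t * ((zeta - 1) / (zeta + 1)).

(** The horodisks at t are the sublevel sets of this function. *)
Definition horo t z : R := cmod2 (t - z) / (1 - cmod2 z).

Lemma circle_cmod2 t : circle t -> cmod2 t = 1.
Proof. by move=> /circle_cmod t1; rewrite -sqr_cmod t1 expr1n. Qed.

Lemma disk_cmod2 z : disk z -> 0 < 1 - cmod2 z.
Proof. by move=> /disk_cmod; rewrite cmod_lt1 subr_gt0. Qed.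

Lemma circle_neq t z : circle t -> disk z -> t != z.
Proof.
move=> /circle_cmod t1 /disk_cmod z1; apply/eqP => tz.
by rewrite -tz t1 ltxx in z1.
Qed.

Lemma circle_disk_dist t z : circle t -> disk z -> 0 < cmod2 (t - z).
Proof. by move=> tc zd; rewrite cmod2_gt0 subr_eq0 circle_neq. Qed.

Lemma horo_gt0 t z : circle t -> disk z -> 0 < horo t z.
Proof.
by move=> tc zd; rewrite divr_gt0 ?disk_cmod2 // circle_disk_dist.
Qed.

Lemma Re_div (a b : C) : Re (a / b) = Re (a * conjc b) / cmod2 b.
Proof.
by case: a b => [a a'] [b b']; rewrite /cmod2 /=; ring.
Qed.

Lemma Re_cay t z : circle t -> Re (cay t z) = (1 - cmod2 z) / cmod2 (t - z).
Proof.
move=> /circle_cmod2 t1; rewrite /cay Re_div -t1; congr (_ / _).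
by case: t z {t1} => [a b] [c d]; rewrite /cmod2 /=; ring.
Qed.

Lemma Re_cay_horo t z : circle t -> Re (cay t z) = (horo t z)^-1.
Proof. by move=> tc; rewrite Re_cay // /horo invf_div. Qed.

Lemma Re_cay_gt0 t z : circle t -> disk z -> 0 < Re (cay t z).
Proof. by move=> tc zd; rewrite Re_cay_horo // invr_gt0 horo_gt0. Qed.

Lemma rhp_add1 zeta : 0 <= Re zeta -> zeta + 1 != 0.
Proof.
move=> z0; apply/eqP => /(congr1 (@complex.Re R)); rewrite ReD /= => H.
by move: z0; have : (0:R) < 1 := ltr01; lra.
Qed.

Lemma cmod2_icay t zeta : circle t -> 0 < Re zeta -> cmod2 (icay t zeta) < 1.
Proof.
move=> /circle_cmod2 t1 z0; rewrite /icay !cmod2M t1 mul1r cmod2V.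
have := rhp_add1 (ltW z0); rewrite -cmod2_gt0 => d0.
rewrite ltr_pdivrMr // mul1r.
case: zeta z0 {d0} => a b /= a0; rewrite /cmod2 /=; lra.
Qed.

Lemma disk_icay t zeta : circle t -> 0 < Re zeta -> disk (icay t zeta).
Proof. by move=> tc z0; apply/disk_cmod; rewrite cmod_lt1 cmod2_icay. Qed.

Lemma circle_neq0 t : circle t -> t != 0.
Proof. by move=> /circle_cmod t1; rewrite -cmod_gt0 t1. Qed.

Lemma icayK t zeta : circle t -> 0 < Re zeta -> cay t (icay t zeta) = zeta.
Proof.
move=> tc z0; have t0 := circle_neq0 tc; have z1 := rhp_add1 (ltW z0).
rewrite /cay /icay.
have two : (2 : C) != 0 by rewrite pnatr_eq0.
have -> : t - t * ((zeta - 1) / (zeta + 1)) = 2 * t / (zeta + 1) by field.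
by field; rewrite z1 t0.
Qed.

Lemma cayK t z : t != 0 -> t != z -> icay t (cay t z) = z.
Proof.
move=> t0 tz; have tz0 : t - z != 0 by rewrite subr_eq0.
have two : (2 : C) != 0 by rewrite pnatr_eq0.
rewrite /icay /cay.
have -> : (t + z) / (t - z) + 1 = 2 * t / (t - z) by field.
by field; rewrite t0 tz0.
Qed.

Lemma cay_sub t z : t != 0 -> t != z -> t - z = 2 * t / (cay t z + 1).
Proof.
move=> t0 tz; have tz0 : t - z != 0 by rewrite subr_eq0.
have two : (2 : C) != 0 by rewrite pnatr_eq0.
rewrite /cay.
have -> : (t + z) / (t - z) + 1 = 2 * t / (t - z) by field.
by field; rewrite t0 tz0.
Qed.

Lemma dist_le_horo t z : circle t -> disk z -> cmod (t - z) <= 2 * horo t z.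
Proof.
move=> tc zd; have p0 := circle_disk_dist tc zd.
have d0 := disk_cmod2 zd.
rewrite /horo mulrA ler_pdivlMr //.
rewrite -!sqr_cmod in d0 *.
have /circle_cmod t1 := tc; have := cmodBl t z; rewrite t1 => H.
have /disk_cmod z1 := zd.
have := cmod_ge0 z; have := cmod_ge0 (t - z) => q0 z0.
have -> : cmod (t - z) * (1 - cmod z ^+ 2) =
   cmod (t - z) * (1 - cmod z) * (1 + cmod z) by ring.
have A : cmod (t - z) * (1 - cmod z) <= cmod (t - z) * cmod (t - z).
  by rewrite ler_wpM2l.
have B : 0 <= cmod (t - z) * (1 - cmod z) by rewrite mulr_ge0 //; lra.
nra.
Qed.

Lemma differentiable_icay t zeta : 0 < Re zeta -> differentiable (icay t) zeta.
Proof.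
move=> z0; apply: differentiableM; first exact: differentiable_cst.
apply: differentiable_div; last exact: rhp_add1 (ltW z0).
- by apply: differentiableB => //; exact: differentiable_cst.
- by apply: differentiableD => //; exact: differentiable_cst.
Qed.

Lemma differentiable_cay t z : t != z -> differentiable (cay t) z.
Proof.
move=> tz; apply: differentiable_div; last by rewrite subr_eq0.
- by apply: differentiableD => //; exact: differentiable_cst.
- by apply: differentiableB => //; exact: differentiable_cst.
Qed.

Lemma cvg_seqP (V : normedModType C) (u : nat -> V) (l : V) :
  u @ \oo --> l <-> forall e : R, 0 < e -> exists N, forall n, (N <= n)%N ->
    rnorm (u n - l) < e.
Proof.
have nR (v : V) (e : R) : (`|v| < rc e) = (rnorm v < e).
  have -> : `|v| = rc (rnorm v).
    rewrite /rnorm; have := normr_ge0 v; case: `|v| => a b.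
    by rewrite lecE /= => /andP[/eqP -> _].
  exact: ltcR.
split=> [/cvgrPdist_lt H e e0|H].
  have [//|N _ HN] := H (rc e); first by rewrite ltcR.
  by exists N => n /HN /=; rewrite distrC nR.
apply/cvgrPdist_lt => e /gt0_rc[x -> x0].
have [N HN] := H x x0.
by exists N => // n /= /HN; rewrite distrC nR.
Qed.

Lemma sqrt_mulr (a x : R) : 0 <= x -> a ^+ 2 * x = (a * Num.sqrt x) ^+ 2.
Proof. by move=> x0; rewrite exprMn sqr_sqrtr. Qed.

(** The orbit of 0 approaches the circle, so infinitely often it does not
    decrease in modulus. The Schwarz-Pick inequality between z and the orbit
    passes to the limit along those times. *)
Lemma wolff f t z : @DW_point R f t -> disk z -> disk (f z) /\ horo t (f z) <= horo t z.
Proof.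
move=> [[hf fd] _ tc ft] zd; have fz := fd z zd; split=> //.
pose u n := iter n f (0 : C).
have u0 : disk (0 : C) by apply/disk_cmod; rewrite cmod0.
have ud n : disk (u n) by elim: n => [//|n IH]; exact: fd.
have ut : forall e : R, 0 < e -> exists N, forall n, (N <= n)%N -> cmod (u n - t) < e.
  by apply/(@cvg_seqP C); exact: ft.
have A0 := disk_cmod2 zd; have B0 := disk_cmod2 fz.
have often N : exists2 n, (N <= n)%N & 1 - cmod2 (u n.+1) <= 1 - cmod2 (u n).
  apply: contrapT => H.
  have inc n : (N <= n)%N -> cmod (u n) <= cmod (u N).
    move=> /subnK <-; elim: (n - N)%N => [|k IH]; first by rewrite add0n.
    rewrite addSn; apply: le_trans IH.
    rewrite leNgt; apply/negP => lt; apply: H; exists (k + N)%N.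
      exact: leq_addl.
    rewrite lerD2l lerN2 -!sqr_cmod lerXn2r ?nnegrE ?cmod_ge0 //.
    exact: ltW.
  have /disk_cmod uN := ud N.
  have [M HM] := ut (1 - cmod (u N)) ltac:(by rewrite subr_gt0).
  have := HM (M + N)%N (leq_addr _ _); have := inc (M + N)%N (leq_addl _ _).
  have /circle_cmod t1 := tc.
  have := cmodBl t (u (M + N)%N); rewrite t1 cmodBC; lra.
have key (d : R) : 0 < d ->
    (cmod (t - f z) - d) * Num.sqrt (1 - cmod2 z) <=
    (cmod (t - z) + d) * Num.sqrt (1 - cmod2 (f z)).
  move=> d0; have [N HN] := ut d d0; have [n Nn an] := often N.
  have un := disk_cmod2 (ud n).
  have df (x : C) : cmod x < 1 -> differentiable f x by move=> /disk_cmod /hf.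
  have f1 (x : C) : cmod x < 1 -> cmod (f x) < 1 by move=> /disk_cmod /fd /disk_cmod.
  have /disk_cmod z1 := zd; have /disk_cmod u1 := ud n.
  have SP := schwarz_pick df f1 z1 u1.
  have near (v y : C) : cmod (v - t) < d -> cmod y < 1 ->
      cmod (t - y) - d <= cmod (1 - conjc v * y) /\
      cmod (1 - conjc v * y) <= cmod (t - y) + d.
    move=> vt y1.
    have E : cmod (1 - conjc t * y) = cmod (t - y).
      have -> : 1 - conjc t * y = conjc t * (t - y).
        have <- : conjc t * t = 1.
          have := circle_cmod2 tc; case: (t) => a b; rewrite /cmod2 /= => ab.
          by apply/eqP; rewrite eq_complex /=; apply/andP; split; apply/eqP; lra.
        by ring.
      by have /circle_cmod t1 := tc; rewrite cmodM cmod_conj t1 mul1r.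
    have D : cmod (conjc (v - t) * y) <= d.
      rewrite cmodM cmod_conj -[leRHS]mulr1.
      by apply: ler_pM; rewrite ?cmod_ge0 ?ltW.
    have Dl : 1 - conjc v * y = (1 - conjc t * y) - conjc (v - t) * y.
      by rewrite rmorphB /=; ring.
    rewrite Dl -E; split.
      by have := cmodBl (1 - conjc t * y) (conjc (v - t) * y); lra.
    by apply: le_trans (cmodB _ _) _; lra.
  have [L _] := near (u n.+1) (f z) (HN _ (leqW Nn)) (f1 _ z1).
  have [_ U] := near (u n) z (HN _ Nn) z1.
  have sA : 0 <= Num.sqrt (1 - cmod2 z) by exact: sqrtr_ge0.
  have sB : 0 <= Num.sqrt (1 - cmod2 (f z)) by exact: sqrtr_ge0.
  apply: le_trans (ler_wpM2r sA L) _; apply: le_trans (ler_wpM2r sB U).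
  rewrite -ler_sqr ?nnegrE ?mulr_ge0 ?cmod_ge0 //.
  rewrite -!sqrt_mulr ?(ltW A0) ?(ltW B0) // !sqr_cmod.
  rewrite -(ler_pM2r un); apply: le_trans (_ : cmod2 (1 - conjc (u n) * z) *
    ((1 - cmod2 (f z)) * (1 - cmod2 (u n.+1))) <= _).
    by move: SP; rewrite /u /= -/(u n) mulrA.
  rewrite -[leRHS]mulrA; apply: ler_wpM2l; first exact: cmod2_ge0.
  by apply: ler_wpM2l => //; exact: ltW.
have lim : cmod (t - f z) * Num.sqrt (1 - cmod2 z) <=
    cmod (t - z) * Num.sqrt (1 - cmod2 (f z)).
  set a := Num.sqrt (1 - cmod2 z) in key *.
  set b := Num.sqrt (1 - cmod2 (f z)) in key *.
  have a0 : 0 <= a by exact: sqrtr_ge0.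
  have b0 : 0 <= b by exact: sqrtr_ge0.
  apply/ler_addgt0Pr => e e0.
  have ab : 0 < a + b + 1 by lra.
  have := key (e / (a + b + 1)) ltac:(by rewrite divr_gt0).
  have : e / (a + b + 1) * (a + b) <= e.
    rewrite mulrAC ler_pdivrMr //; have : 0 < e by []. nra.
  lra.
rewrite /horo ler_pdivrMr // mulrAC ler_pdivlMr //.
move: lim; rewrite -ler_sqr ?nnegrE ?mulr_ge0 ?cmod_ge0 ?sqrtr_ge0 //.
by rewrite -!sqrt_mulr ?(ltW A0) ?(ltW B0) // !sqr_cmod.
Qed.

End Cayley.

(** * Neighbourhoods and norms on the bidisk *)

Section Norms.
Context {R : realType}.
Local Notation C := R[i].

Lemma norm_rnorm (V : normedModType C) (v : V) : `|v| = rc (rnorm v).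
Proof.
rewrite /rnorm; have := normr_ge0 v; case: `|v| => a b.
by rewrite lecE /= => /andP[/eqP -> _].
Qed.

Lemma rnorm_ge0 (V : normedModType C) (v : V) : 0 <= rnorm v.
Proof. by have := normr_ge0 v; rewrite norm_rnorm lecR. Qed.

Lemma rnorm_pair (p : C * C) : rnorm p = Num.max (cmod p.1) (cmod p.2).
Proof.
rewrite /rnorm prod_normE !normE /Num.max ltcR.
by rewrite /Order.max; case: ifP.
Qed.

Lemma rnorm_le_pair (p : C * C) : cmod p.1 <= rnorm p /\ cmod p.2 <= rnorm p.
Proof. by rewrite rnorm_pair !le_max !lexx orbT. Qed.

Lemma rnorm_distC (V : normedModType C) (u v : V) : rnorm (u - v) = rnorm (v - u).
Proof. by rewrite /rnorm distrC. Qed.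

Lemma bidisk_rnorm (p : C * C) : bidisk p -> rnorm p < 1.
Proof.
by move=> [/disk_cmod p1 /disk_cmod p2]; rewrite rnorm_pair gt_max p1.
Qed.

Lemma nbhs_rnormP (V : normedModType C) (p : V) (A : set V) :
  nbhs p A <-> exists2 d : R, 0 < d & forall q, rnorm (q - p) < d -> A q.
Proof.
split=> [/nbhs_ballP[d /= /gt0_rc[x -> x0] H]|[d d0 H]].
  exists x => // q qp; apply: H.
  by rewrite -ball_normE /= norm_rnorm ltcR rnorm_distC.
apply/nbhs_ballP; exists (rc d) => /=; first by rewrite ltcR.
move=> q; rewrite -ball_normE /= norm_rnorm ltcR rnorm_distC; exact: H.
Qed.

Lemma within_cvgP (V : normedModType C) (f : V -> C) (S : set V) (p : V) (l : C) :
  (forall e : R, 0 < e -> exists2 d : R, 0 < d &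
    forall q, S q -> rnorm (q - p) < d -> cmod (f q - l) <= e) ->
  f q @[q --> within S (nbhs p)] --> l.
Proof.
move=> H; apply/cvgrPdist_le => e /gt0_rc[x -> x0].
have [d d0 Hd] := H x x0.
apply/nbhs_rnormP; exists d => // q qp Sq.
by rewrite normE lecR cmodBC; exact: Hd.
Qed.

Lemma seq_cvg_unique (f : nat -> C) (a b : C) :
  f @ \oo --> a -> f @ \oo --> b -> a = b.
Proof.
move=> /(@cvg_seqP R C) fa /(@cvg_seqP R C) fb.
apply/eqP; rewrite -subr_eq0 -cmod_eq0 eq_le cmod_ge0 andbT.
apply/ler_addgt0Pr => e e0; rewrite add0r.
have [N HN] := fa (e / 2) ltac:(by rewrite divr_gt0).
have [N' HN'] := fb (e / 2) ltac:(by rewrite divr_gt0).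
have := HN _ (leq_addr N' N); have := HN' _ (leq_addl N N').
rewrite !rnormE [cmod (_ - a)]cmodBC => h1 h2.
have -> : a - b = (a - f (N + N')%N) + (f (N + N')%N - b) by ring.
by apply: le_trans (cmodD _ _) _; lra.
Qed.

Lemma cvg_comp_fst (l : nat -> C * C) (q : C * C) :
  l @ \oo --> q -> (fun n => (l n).1) @ \oo --> q.1.
Proof.
move=> /cvg_seqP lq; apply/(@cvg_seqP _ C) => e e0; have [N HN] := lq e e0.
by exists N => n /HN; apply: le_lt_trans; have [] := rnorm_le_pair (l n - q).
Qed.

Lemma cvg_comp_snd (l : nat -> C * C) (q : C * C) :
  l @ \oo --> q -> (fun n => (l n).2) @ \oo --> q.2.
Proof.
move=> /cvg_seqP lq; apply/(@cvg_seqP _ C) => e e0; have [N HN] := lq e e0.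
by exists N => n /HN; apply: le_lt_trans; have [] := rnorm_le_pair (l n - q).
Qed.

Lemma differentiable_fst (V : normedModType C) (F : V -> C * C) x :
  differentiable F x -> differentiable (fun y => (F y).1) x.
Proof.
move=> dF; apply: (differentiable_comp dF).
by apply: (@linear_differentiable _ _ _ (@fst C C)) => p; exact: cvg_fst.
Qed.

Lemma radial_bidisk (tau sigma : C) (r : R) : circle tau -> circle sigma ->
  0 < r < 1 ->
  bidisk (rc r * tau, rc r * sigma) /\ rnorm (rc r * tau, rc r * sigma) = r /\
  rnorm ((rc r * tau, rc r * sigma) - (tau, sigma)) = 1 - r.
Proof.
move=> /circle_cmod t1 /circle_cmod s1 /andP[r0 r1].
have E (t : C) : cmod t = 1 -> cmod (rc r * t) = r.
  by move=> tt; rewrite cmodM tt mulr1 cmod_rc gtr0_norm.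
have E2 (t : C) : cmod t = 1 -> cmod (rc r * t - t) = 1 - r.
  move=> tt; have -> : rc r * t - t = rc (r - 1) * t by rewrite rcB mulrBl mul1r.
  by rewrite cmodM tt mulr1 cmod_rc ltr0_norm ?opprB // subr_lt0.
split; first by split; apply/disk_cmod; rewrite /= E.
split; first by rewrite rnorm_pair /= !E // maxxx.
by rewrite rnorm_pair /= !E2 // maxxx.
Qed.

Lemma horo_radial (t : C) (r : R) : circle t -> 0 < r < 1 ->
  horo t (rc r * t) <= 1 - r.
Proof.
move=> tc /andP[r0 r1]; have t1 := circle_cmod2 tc; rewrite /horo.
have -> : t - rc r * t = rc (1 - r) * t by rewrite rcB mulrBl mul1r.
rewrite !cmod2M t1 !mulr1.
have -> : cmod2 (rc (1 - r)) = (1 - r) ^+ 2 by rewrite /cmod2 /=; ring.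
have -> : cmod2 (rc r) = r ^+ 2 by rewrite /cmod2 /=; ring.
have : 0 < 1 - r ^+ 2 by rewrite subr_gt0 -(expr1n _ 2) ltrXn2r // ltW.
move=> d0; rewrite ler_pdivrMr //.
have : 0 <= (1 - r) * ((1 - r) * r) by rewrite !mulr_ge0 // ?subr_ge0 ltW.
lra.
Qed.

End Norms.

(** * Functions decreasing the horodisks at tau in the first variable *)

Section TypeOne.
Context {R : realType}.
Local Notation C := R[i].
Local Notation Re := complex.Re.
Variables (phi : C * C -> C) (tau sigma : C).
Hypothesis tauc : circle tau.
Hypothesis sigmac : circle sigma.
Hypothesis phid : forall z w, disk z -> disk w -> differentiable phi (z, w).
Hypothesis phiD : forall z w, disk z -> disk w -> disk (phi (z, w)).
Hypothesis phiW : forall z w, disk z -> disk w ->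
  horo tau (phi (z, w)) <= horo tau z.

(** In half-plane coordinates sending (tau, sigma) to (oo, oo), the increment
    of the first coordinate under phi. *)
Definition drift (p : C * C) : C :=
  cay tau (phi (icay tau p.1, icay sigma p.2)) - p.1.

Lemma drift_diff (a b c d u : C) : 0 < Re (a + u * c) -> 0 < Re (b + u * d) ->
  differentiable (fun v : C => drift (a + v * c, b + v * d)) u.
Proof.
move=> p1 p2; rewrite /drift /=.
have dl (x y : C) : differentiable (fun v : C => x + v * y) u.
  apply: differentiableD; first exact: differentiable_cst.
  by apply: differentiableM => //; exact: differentiable_cst.
have D1 := disk_icay tauc p1; have D2 := disk_icay sigmac p2.
apply: differentiableB; last exact: dl.
apply: (@differentiable_compC _ _ (cay tau)).
  apply: differentiable_curve; last exact: phid.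
    exact: differentiable_compC (dl a c) (differentiable_icay tau p1).
  exact: differentiable_compC (dl b d) (differentiable_icay sigma p2).
by apply: differentiable_cay; apply: circle_neq => //; exact: phiD.
Qed.

Lemma drift_ge0 (a b : C) : 0 < Re a -> 0 < Re b -> 0 <= Re (drift (a, b)).
Proof.
move=> a0 b0; rewrite /drift /= ReD ReN subr_ge0.
have D1 := disk_icay tauc a0; have D2 := disk_icay sigmac b0.
rewrite -{1}(icayK tauc a0) !Re_cay_horo //.
rewrite lef_pV2 ?posrE ?horo_gt0 //; first exact: phiW.
exact: phiD.
Qed.

Definition drift_linear := exists2 k : R, 0 < k & forall t : R, 0 < t ->
  k * t <= Re (drift (rc t, rc t)).

Lemma driftE z w : disk z -> disk w ->
  cay tau (phi (z, w)) = cay tau z + drift (cay tau z, cay sigma w).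
Proof.
move=> zd wd; rewrite /drift /= !cayK ?circle_neq0 ?circle_neq //.
by ring.
Qed.

(** [diag_growth] read in the bidisk. *)
Lemma horo_increment : drift_linear ->
  exists2 k : R, 0 < k & forall z w m, disk z -> disk w -> 0 < m ->
    m <= (horo tau z)^-1 -> m <= (horo sigma w)^-1 ->
    (horo tau z)^-1 + k * m <= (horo tau (phi (z, w)))^-1.
Proof.
move=> [k k0 Hk]; exists (k / 32); first by rewrite divr_gt0.
move=> z w m zd wd m0; rewrite -!Re_cay_horo // => mz mw.
rewrite driftE // ReD lerD2l.
have := diag_growth drift_diff drift_ge0 k0 Hk m0 mz mw.
by rewrite mulrAC.
Qed.

Lemma phi_dist z w : disk z -> disk w -> cmod (tau - phi (z, w)) <= 2 * horo tau z.
Proof.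
move=> zd wd; apply: le_trans (dist_le_horo tauc (phiD zd wd)) _.
by rewrite ler_pM2l //; exact: phiW.
Qed.

(** Along the radius to (tau, sigma) the quotient is at most 2, since phi moves
    no point out of its horodisk. *)
Lemma phi_B_point : B_point phi (tau, sigma).
Proof.
have /circle_cmod t1 := tauc; have /circle_cmod s1 := sigmac.
split; first by rewrite norm_rnorm rnorm_pair /= t1 s1 maxxx.
apply: (@le_lt_trans _ _ 2%:E); last exact: ltry.
rewrite limf_einfE; apply: ge_ereal_sup => _ [V /= HV <-].
have [d d0 Hd] := (nbhs_rnormP _ _).1 HV.
pose r := 1 - Num.min (d / 2) (1 / 2).
have rd : 1 - r < d.
  by rewrite /r opprB addrC subrK gt_min; apply/orP; left; lra.
have r01 : 0 < r < 1.
  rewrite /r; apply/andP; split.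
    by rewrite subr_gt0 gt_min; apply/orP; right; lra.
  by rewrite ltrBlDr ltrDl lt_min; apply/andP; split; lra.
have [lb [ln ld]] := radial_bidisk tauc sigmac r01.
apply: ge_ereal_inf.
exists (julia_quotient phi (rc r * tau, rc r * sigma))%:E.
  exists (rc r * tau, rc r * sigma) => //; apply: Hd => //.
  by rewrite ld.
rewrite lee_fin /julia_quotient ln rnormE.
have /andP[r0 r1] := r01.
rewrite ler_pdivrMr ?subr_gt0 //.
have lb1 : disk (rc r * tau) := lb.1; have lb2 : disk (rc r * sigma) := lb.2.
have A := phi_dist lb1 lb2; have B := horo_radial tauc r01.
have D := cmodBl tau (phi (rc r * tau, rc r * sigma)); rewrite t1 in D.
by apply: le_trans D _; apply: le_trans A _; rewrite ler_pM2l.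
Qed.

Lemma nontangentialP (S : set (C * C)) : approaches_nt S (tau, sigma) ->
  exists2 c : R, 1 <= c & forall l, S l -> [/\ disk l.1, disk l.2,
    0 < rnorm (l - (tau, sigma)),
    cmod (tau - l.1) <= rnorm (l - (tau, sigma))
      <= c * (1 - cmod l.1) &
    cmod (sigma - l.2) <= rnorm (l - (tau, sigma))
      <= c * (1 - cmod l.2)].
Proof.
move=> [Sb [_ [_ /gt0_rc[c -> c0] Hc]]].
exists (Num.max c 1); first by rewrite le_max lexx orbT.
move=> l Sl; have [l1 l2] := Sb _ Sl.
have H : rnorm (l - (tau, sigma)) <= c * (1 - rnorm l).
  have := Hc _ Sl; rewrite !norm_rnorm rnorm_distC.
  have -> : rc c * (1 - rc (rnorm l)) = rc (c * (1 - rnorm l)).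
    by apply/eqP; rewrite eq_complex /=; apply/andP; split; apply/eqP; ring.
  by rewrite lecR.
have n1 := bidisk_rnorm (Sb _ Sl).
have [a1 a2] := rnorm_le_pair l.
have [b1 b2] := rnorm_le_pair (l - (tau, sigma)).
have H2 : rnorm (l - (tau, sigma)) <= Num.max c 1 * (1 - rnorm l).
  apply: le_trans H _; apply: ler_wpM2r; first by rewrite subr_ge0 ltW.
  by rewrite le_max lexx.
have m0 : 0 <= Num.max c 1 by rewrite le_max ler01 orbT.
have K (x : R) : x <= rnorm l -> Num.max c 1 * (1 - rnorm l) <= Num.max c 1 * (1 - x).
  by move=> xl; rewrite ler_wpM2l // lerD2l lerN2.
split; [exact: l1|exact: l2| | |].
- apply: lt_le_trans b1; rewrite cmod_gt0 /= subr_eq0 eq_sym.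
  exact: circle_neq.
- by rewrite cmodBC b1 /= (le_trans H2) // K.
- by rewrite cmodBC b2 /= (le_trans H2) // K.
Qed.

Lemma horo_nt (t z : C) (c d : R) : circle t -> disk z -> 0 < d -> 1 <= c ->
  cmod (t - z) <= d <= c * (1 - cmod z) ->
  [/\ horo t z <= c * d, (c * d)^-1 <= Re (cay t z) & cmod (cay t z) <= 3 * c / d].
Proof.
move=> tc zd d0 c1 /andP[h1 h2].
have c0 : 0 < c by lra.
have D0 := disk_cmod2 zd; have P0 := circle_disk_dist tc zd.
have /disk_cmod z1 := zd; have /circle_cmod t1 := tc.
have H : horo t z <= c * d.
  rewrite /horo ler_pdivrMr // -!sqr_cmod.
  have A : cmod (t - z) ^+ 2 <= d * d by rewrite expr2; apply: ler_pM; rewrite ?cmod_ge0.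
  have B : d * d <= d * (c * (1 - cmod z)) by rewrite ler_pM2l.
  have z0 := cmod_ge0 z.
  have E : 0 <= (c * d) * (cmod z * (1 - cmod z)).
    by rewrite !mulr_ge0 ?subr_ge0 // ltW.
  lra.
split => //.
  by rewrite Re_cay_horo // lef_pV2 ?posrE ?horo_gt0 // mulr_gt0.
rewrite /cay cmodM cmodV.
have q0 : 0 < cmod (t - z) by rewrite cmod_gt0 subr_eq0 circle_neq.
have q1 : d / c <= cmod (t - z).
  rewrite ler_pdivrMr // mulrC; apply: le_trans h2 _.
  by rewrite ler_pM2l //; have := cmodBl t z; rewrite t1.
have n2 : cmod (t + z) <= 3 by apply: le_trans (cmodD _ _) _; rewrite t1; lra.
have -> : 3 * c / d = 3 * (d / c)^-1 by rewrite invf_div mulrA.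
apply: ler_pM; rewrite ?cmod_ge0 ?invr_ge0 ?cmod_ge0 //.
by rewrite lef_pV2 ?posrE // divr_gt0.
Qed.

Lemma phi_nt_limit : nt_limit phi (tau, sigma) tau.
Proof.
move=> S /nontangentialP[c c1 Hc]; apply: within_cvgP => e e0.
have c0 : 0 < c by lra.
exists (e / (2 * c)); first by rewrite divr_gt0 // mulr_gt0.
move=> [z w] /Hc /= [zd wd d0 h1 _]; rewrite ltr_pdivlMr ?mulr_gt0 // => dd.
have [H _ _] := horo_nt tauc zd d0 c1 h1.
rewrite cmodBC; apply: le_trans (phi_dist zd wd) _.
by lra.
Qed.

(** If the drift is not of linear order along the diagonal, then it is
    negligible nontangentially, and phi agrees with the first coordinate to
    first order at (tau, sigma). *)
Lemma phi_C_point : ~ drift_linear -> C_point phi (tau, sigma).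
Proof.
move=> nd; split; first exact: phi_B_point.
exists tau; first exact: phi_nt_limit.
exists (1, 0) => S /nontangentialP[c c1 Hc] e' /gt0_rc[e -> e0].
have c0 : 0 < c by lra.
have ec : 0 < e / c by rewrite divr_gt0.
have [d0 d00 small] := nontangential_small drift_diff drift_ge0 c1 nd ec.
apply/nbhs_rnormP; exists d0 => // -[z w] dd Sl.
have [/= zd wd dp h1 h2] := Hc _ Sl.
rewrite [X in `|X|](_ : _ = phi (z, w) - z); last by ring.
rewrite !norm_rnorm rnormE.
set d := rnorm _ in dd dp h1 h2 *.
have -> : rc e * rc d = rc (e * d).
  by apply/eqP; rewrite eq_complex /=; apply/andP; split; apply/eqP; ring.
rewrite lecR.
have [_ Rz Mz] := horo_nt tauc zd dp c1 h1.
have [_ Rw Mw] := horo_nt sigmac wd dp c1 h2.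
have G := small d _ _ dp dd Rz Rw Mz Mw.
have fd := phiD zd wd.
have cd0 : 0 < c * d by rewrite mulr_gt0.
have Rz0 : 0 < Re (cay tau z) by exact: Re_cay_gt0.
have Rf0 : 0 < Re (cay tau (phi (z, w))) by exact: Re_cay_gt0.
have Rf : (c * d)^-1 <= cmod (cay tau (phi (z, w)) + 1).
  apply: le_trans Rz _; apply: le_trans (Re_le_cmod _).
  rewrite driftE // (ReD (_ + _) 1) (ReD (cay tau z)); have := drift_ge0 Rz0 (Re_cay_gt0 sigmac wd).
  by have -> : Re (1 : C) = 1 by []; lra.
have t0 := circle_neq0 tauc.
have E : phi (z, w) - z = (tau - z) * (drift (cay tau z, cay sigma w) /
    (cay tau (phi (z, w)) + 1)).
  have -> : phi (z, w) - z = (tau - z) - (tau - phi (z, w)) by ring.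
  rewrite !(cay_sub t0) ?circle_neq //.
  have := driftE zd wd; set h := cay tau (phi _) => hE.
  have -> : drift (cay tau z, cay sigma w) = h - cay tau z by rewrite hE; ring.
  field; rewrite !rhp_add1 //; exact: ltW.
rewrite E !cmodM cmodV.
have /andP[h1a _] := h1.
have I : (cmod (cay tau (phi (z, w)) + 1))^-1 <= c * d.
  rewrite -[leRHS]invrK lef_pV2 ?posrE ?invr_gt0 //.
  by apply: lt_le_trans Rf; rewrite invr_gt0.
have -> : e * d = d * ((e / c / d) * (c * d)) by field; rewrite !gt_eqF.
apply: ler_pM; rewrite ?cmod_ge0 ?mulr_ge0 ?invr_ge0 ?cmod_ge0 //.
by apply: ler_pM; rewrite ?cmod_ge0 ?invr_ge0 ?cmod_ge0.
Qed.

End TypeOne.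

(** * Julia's inequality at a boundary point of a model *)

Section Hilbert.
Context {R : realType}.
Local Notation C := R[i].
Variable H : hilbertSpace R.
Implicit Types u v w : H.

Lemma hdot_sqr u : hdot H u u = rc (rnorm u ^+ 2).
Proof.
rewrite -hdot_norm norm_rnorm.
by apply/eqP; rewrite eq_complex /=; apply/andP; split; apply/eqP; ring.
Qed.

Lemma hdot_conj u v : hdot H v u = conjc (hdot H u v).
Proof. by rewrite (hermC (hdot H)) mul1r. Qed.

Lemma hdotDl u v w : hdot H (u + v) w = hdot H u w + hdot H v w.
Proof. exact: linearDl. Qed.

Lemma hdot_cauchy_schwarz u v : cmod (hdot H u v) <= rnorm u * rnorm v.
Proof.
have [v0|vn0] := eqVneq (rnorm v) 0.
  have -> : v = 0 by apply/normr0_eq0; rewrite norm_rnorm v0.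
  by rewrite linear0r cmod0 mulr_ge0 ?rnorm_ge0.
have N0 : 0 < rnorm v ^+ 2 by rewrite exprn_even_gt0.
set x := hdot H u v; set N := rnorm v ^+ 2 in N0.
have := hdot_sqr (u - (x / rc N) *: v).
rewrite (dnormB (hdot H)) (dnormZ (hdot H)) (linearZr_LR (hdot H)) /= -/x !hdot_sqr -/N.
move=> /(congr1 (@complex.Re R)) E.
have {}E : rnorm u ^+ 2 + cmod2 x / N - 2 * (cmod2 x / N) =
  rnorm (u - x / rc N *: v) ^+ 2.
  rewrite -[RHS]/(complex.Re (rc (rnorm (u - x / rc N *: v) ^+ 2))) -E.
  rewrite normE cmodM cmodV cmod_rc (gtr0_norm N0) -sqr_cmod.
  have : complex.Re (((x / rc N)^*)%R * x) = cmod x ^+ 2 / N.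
    rewrite conjE sqr_cmod; case: (x) => a b; rewrite /cmod2 /=.
    by field; rewrite gt_eqF.
  move: (cmod x) => k; set d := _ * x.
  rewrite expr2; case: d => d1 d2 /= ->.
  by field; rewrite gt_eqF.
rewrite cmod_le ?mulr_ge0 ?rnorm_ge0 // exprMn -/N -ler_pdivrMr //.
by have := sqr_ge0 (rnorm (u - x / rc N *: v)); rewrite -E; lra.
Qed.

End Hilbert.

Section Model.
Context {R : realType}.
Local Notation C := R[i].
Variables (p : C * C -> C) (M : model p).
Local Notation H := (mspace M).
Let u1 l : H := pr1 (mdec M) (mmap M l).
Let u2 l : H := pr2 (mdec M) (mmap M l).

Lemma hdot_pr1 (v w : H) :
  hdot H v (pr1 (mdec M) w) = hdot H (pr1 (mdec M) v) (pr1 (mdec M) w).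
Proof.
rewrite {1}(pr_sum (mdec M) v) hdotDl [X in _ + X]hdot_conj.
by rewrite (summands_ortho (pr1_in (mdec M) w) (pr2_in (mdec M) v)) rmorph0 addr0.
Qed.

Lemma hdot_pr2 (v w : H) :
  hdot H v (pr2 (mdec M) w) = hdot H (pr2 (mdec M) v) (pr2 (mdec M) w).
Proof.
rewrite {1}(pr_sum (mdec M) v) hdotDl.
by rewrite (summands_ortho (pr1_in (mdec M) v) (pr2_in (mdec M) w)) add0r.
Qed.

Lemma weighted_cauchy_schwarz (P1 P2 D1 D2 a1 a2 b1 b2 : R) : 0 < D1 -> 0 < D2 ->
  (P1 * (b1 * a1) + P2 * (b2 * a2)) ^+ 2 <=
  (D1 * a1 ^+ 2 + D2 * a2 ^+ 2) * (b1 ^+ 2 * (P1 ^+ 2 / D1) + b2 ^+ 2 * (P2 ^+ 2 / D2)).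
Proof.
move=> d1 d2; rewrite -subr_ge0.
rewrite (_ : _ - _ = (D1 * a1 * (b2 * P2) - D2 * a2 * (b1 * P1)) ^+ 2 / (D1 * D2)).
  by rewrite divr_ge0 ?sqr_ge0 // ltW // mulr_gt0.
by field; rewrite !gt_eqF.
Qed.

Hypothesis pD : forall l, bidisk l -> disk (p l).

Lemma bounded_quotient_limit (l : nat -> C * C) (q : C * C) (c : R) :
  (forall n, bidisk (l n)) -> rnorm q = 1 -> l @ \oo --> q ->
  (forall n, julia_quotient p (l n) <= c) ->
  forall e : R, 0 < e -> exists N, forall n, (N <= n)%N -> 1 - cmod (p (l n)) < e.
Proof.
move=> lb q1 /cvg_seqP lq qc e e0.
have c0 : 0 < `|c| + 1 by rewrite ltr_wpDl.
have [N HN] := lq (e / (`|c| + 1)) ltac:(by rewrite divr_gt0).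
exists N => n /HN; rewrite ltr_pdivlMr //.
have := qc n; have := bidisk_rnorm (lb n).
rewrite /julia_quotient rnormE => n1; rewrite ler_pdivrMr ?subr_gt0 // => A B.
have C1 : 1 - rnorm (l n) <= rnorm (l n - q).
  by have := lerB_dist q (l n); rewrite !norm_rnorm -rcB lecR q1 rnorm_distC.
apply: le_lt_trans A _; apply: le_lt_trans B; rewrite [leRHS]mulrC.
apply: le_trans (ler_wpM2l (ltW c0) C1); apply: ler_wpM2r.
  by rewrite subr_ge0 ltW.
by apply: le_trans (ler_norm c) _; rewrite lerDl.
Qed.

(** The identity between l_n and l has l_n in one argument of each inner product
    only, so weak convergence is enough; it also shows that p(l_n) converges. *)
Lemma model_limit (s t : C) v : circle s -> circle t ->
  cluster_vectors M (s, t) v -> exists2 y : C, circle y &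
    forall l, bidisk l -> 1 - y * conjc (p l) =
      (1 - s * conjc l.1) * hdot H (pr1 (mdec M) v) (u1 l) +
      (1 - t * conjc l.2) * hdot H (pr2 (mdec M) v) (u2 l).
Proof.
move=> sc tc [l [lb lq [c qc] wl]].
have /circle_cmod s1 := sc; have /circle_cmod t1 := tc.
have q1 : rnorm ((s, t) : C * C) = 1 by rewrite rnorm_pair /= s1 t1 maxxx.
have to1 := bounded_quotient_limit lb q1 lq qc.
pose Y m := (1 - s * conjc m.1) * hdot H (pr1 (mdec M) v) (u1 m) +
            (1 - t * conjc m.2) * hdot H (pr2 (mdec M) v) (u2 m).
have aff (f : nat -> C) (a b : C) : f @ \oo --> a ->
    (fun n => 1 - f n * b) @ \oo --> 1 - a * b.
  move=> fa; exact: (cvgB (cvg_cst (1 : C)) (cvgM fa (cvg_cst b))).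
have Ycvg m : bidisk m -> (fun n => 1 - p (l n) * conjc (p m)) @ \oo --> Y m.
  move=> mb.
  have -> : (fun n => 1 - p (l n) * conjc (p m)) = (fun n =>
     (1 - (l n).1 * conjc m.1) * hdot H (mmap M (l n)) (u1 m) +
     (1 - (l n).2 * conjc m.2) * hdot H (mmap M (l n)) (u2 m)).
    apply/funext => n; rewrite /u1 /u2 (hdot_pr1 (mmap M (l n))) hdot_pr2.
    by rewrite -!conjE; exact: model_eq.
  rewrite /Y -(hdot_pr1 v) -(hdot_pr2 v).
  exact: (cvgD (cvgM (aff _ _ _ (cvg_comp_fst lq)) (wl (u1 m)))
               (cvgM (aff _ _ _ (cvg_comp_snd lq)) (wl (u2 m)))).
have [m [mb pm]] : exists m, bidisk m /\ p m != 0.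
  have [N HN] := to1 1 ltr01; exists (l N); split; first exact: lb.
  by rewrite -cmod_gt0; have := HN N (leqnn N); lra.
have pm' : conjc (p m) != 0 by rewrite -cmod_gt0 cmod_conj cmod_gt0.
pose y := (1 - Y m) / conjc (p m).
have py : (fun n => p (l n)) @ \oo --> y.
  have -> : (fun n => p (l n)) = (fun n => (1 - (1 - p (l n) * conjc (p m))) / conjc (p m)).
    by apply/funext => n; field.
  exact: (cvgM (cvgB (cvg_cst (1 : C)) (Ycvg m mb)) (cvg_cst (conjc (p m))^-1)).
have yY m' : bidisk m' -> 1 - y * conjc (p m') = Y m'.
  by move=> mb'; exact: seq_cvg_unique (aff _ _ _ py) (Ycvg m' mb').
exists y => //; apply/circle_cmod/eqP; rewrite eq_le; apply/andP; split.
  apply/ler_addgt0Pr => e e0.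
  have [N HN] := (@cvg_seqP R C _ _).1 py e e0.
  have := HN N (leqnn N); rewrite rnormE cmodBC => h.
  have := cmodBl y (p (l N)); have /disk_cmod := pD (lb N); lra.
apply/ler_addgt0Pr => e e0.
have [N HN] := (@cvg_seqP R C _ _).1 py (e / 2) ltac:(by rewrite divr_gt0).
have [N' HN'] := to1 (e / 2) ltac:(by rewrite divr_gt0).
have := HN _ (leq_addr N' N); have := HN' _ (leq_addl N N').
rewrite rnormE => h1 h2.
by have := cmodBl (p (l (N + N')%N)) y; lra.
Qed.

(** With the limiting model identity, Cauchy-Schwarz in the space and then in
    the two weighted terms bounds |y - p(l)|^2 by 1 - |p(l)|^2 times the
    right-hand side. On the radius that bound forces p to tend to y, so y is the
    nontangential limit s. *)
Lemma model_julia (s t : C) v : circle s -> circle t ->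
  cluster_vectors M (s, t) v -> nt_limit p (s, t) s ->
  forall l, bidisk l -> horo s (p l) <=
     rnorm (pr1 (mdec M) v) ^+ 2 * horo s l.1 +
     rnorm (pr2 (mdec M) v) ^+ 2 * horo t l.2.
Proof.
move=> sc tc vY pnt; have [y yc Hy] := model_limit sc tc vY.
set a := rnorm (pr1 _ v) ^+ 2; set b := rnorm (pr2 _ v) ^+ 2.
have conj_dist (r z : C) : circle r -> cmod (1 - r * conjc z) = cmod (r - z).
  move=> rc'; have /circle_cmod r1 := rc'.
  have -> : 1 - r * conjc z = r * conjc (r - z).
    rewrite rmorphB /= mulrBr; congr (_ - _).
    have := circle_cmod2 rc'; case: (r) => x x'; rewrite /cmod2 /= => xx.
    by apply/eqP; rewrite eq_complex /=; apply/andP; split; apply/eqP; lra.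
  by rewrite cmodM r1 mul1r cmod_conj.
have main l : bidisk l -> horo y (p l) <= a * horo s l.1 + b * horo t l.2.
  move=> lb; have pl := disk_cmod2 (pD lb).
  have d1 := disk_cmod2 lb.1; have d2 := disk_cmod2 lb.2.
  have U : 1 - cmod2 (p l) =
      (1 - cmod2 l.1) * rnorm (u1 l) ^+ 2 + (1 - cmod2 l.2) * rnorm (u2 l) ^+ 2.
    have := model_eq M lb lb; rewrite -/(u1 l) -/(u2 l) !hdot_sqr !conjE.
    have cc (z : C) : z * conjc z = rc (cmod2 z).
      case: z => x x'; rewrite /cmod2.
      by apply/eqP; rewrite eq_complex /=; apply/andP; split; apply/eqP; ring.
    rewrite !cc -!(@rcB R 1) => /(congr1 (@complex.Re R)) /= ->.
    by ring.
  rewrite /horo ler_pdivrMr // {1}U.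
  have := Hy l lb => /(congr1 (@cmod R)); rewrite conj_dist // => E.
  have T : cmod (y - p l) <=
     cmod (s - l.1) * (rnorm (pr1 (mdec M) v) * rnorm (u1 l)) +
     cmod (t - l.2) * (rnorm (pr2 (mdec M) v) * rnorm (u2 l)).
    rewrite E; apply: le_trans (cmodD _ _) _; rewrite !cmodM !conj_dist //.
    by apply: lerD; apply: ler_wpM2l; rewrite ?cmod_ge0 //; exact: hdot_cauchy_schwarz.
  rewrite -!sqr_cmod; apply: le_trans (_ : _ <= (cmod (s - l.1) * (rnorm (pr1 (mdec M) v) * rnorm (u1 l)) +
     cmod (t - l.2) * (rnorm (pr2 (mdec M) v) * rnorm (u2 l))) ^+ 2) _.
    by rewrite lerXn2r ?nnegrE ?cmod_ge0 // (le_trans (cmod_ge0 _) T).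
  rewrite !sqr_cmod -!(sqr_cmod (_ - _)) [leRHS]mulrC.
  exact: weighted_cauchy_schwarz.
suff sy : s = y by move=> l lb; rewrite {1}sy; exact: main.
have a0 : 0 <= a by exact: sqr_ge0.
have b0 : 0 <= b by exact: sqr_ge0.
pose S : set (C * C) := [set (rc r * s, rc r * t) | r in [set r : R | 0 < r < 1]].
have Snt : approaches_nt S (s, t).
  split; [|split].
  - by move=> _ [r r01 <-]; have [] := radial_bidisk sc tc r01.
  - move=> B /nbhs_rnormP[d d0 Hd].
    pose r := 1 - Num.min (d / 2) (1 / 2).
    have rd : 1 - r < d.
      by rewrite /r opprB addrC subrK gt_min; apply/orP; left; lra.
    have r01 : 0 < r < 1.
      rewrite /r; apply/andP; split.
        by rewrite subr_gt0 gt_min; apply/orP; right; lra.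
      by rewrite ltrBlDr ltrDl lt_min; apply/andP; split; lra.
    have [_ [_ E]] := radial_bidisk sc tc r01.
    by exists (rc r * s, rc r * t); split; [exists r|apply: Hd; rewrite E].
  - exists 1 => // _ [r r01 <-]; have [_ [E1 E2]] := radial_bidisk sc tc r01.
    by rewrite !norm_rnorm rnorm_distC E1 E2 mul1r rcB.
have close (e : R) : 0 < e -> cmod (s - y) <= e.
  move=> e0.
  have /cvgrPdist_le/(_ (rc (e / 2)) ltac:(by rewrite ltcR divr_gt0)) := pnt S Snt.
  move=> /nbhs_rnormP[d d0 Hd].
  pose k := 4 * (a + b + 1).
  have k0 : 0 < k by rewrite /k; lra.
  pose x := Num.min (Num.min (d / 2) (1 / 2)) (e / k).
  have x0 : 0 < x by rewrite !lt_min !divr_gt0.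
  have xd : x < d by rewrite !gt_min; apply/orP; left; apply/orP; left; lra.
  have x1 : x < 1 by rewrite !gt_min; apply/orP; left; apply/orP; right; lra.
  have xe : x * k <= e by rewrite -ler_pdivlMr // ge_min lexx orbT.
  have r01 : 0 < 1 - x < 1 by apply/andP; split; lra.
  have [lb [E1 E2]] := radial_bidisk sc tc r01.
  have := Hd (rc (1 - x) * s, rc (1 - x) * t).
  rewrite E2 opprB addrC subrK => /(_ xd) H1.
  have {H1} := H1 (ex_intro2 _ _ (1 - x) r01 erefl).
  rewrite normE lecR => H1.
  have H2 := dist_le_horo yc (pD lb).
  have H3 := main _ lb.
  have H4 := horo_radial sc r01; have H5 := horo_radial tc r01.
  have xx : 1 - (1 - x) = x by ring.
  rewrite xx in H4 H5.
  have H6 := lerD (ler_wpM2l a0 H4) (ler_wpM2l b0 H5).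
  have H7 : a * x + b * x <= e / 4.
    by move: xe; rewrite /k; clear -x0; lra.
  rewrite (splitr e).
  have -> : s - y = (s - p (rc (1 - x) * s, rc (1 - x) * t)) -
     (y - p (rc (1 - x) * s, rc (1 - x) * t)) by ring.
  apply: le_trans (cmodB _ _) _; apply: lerD H1 _.
  apply: le_trans H2 _; have -> : e / 2 = 2 * (e / 4) by field.
  by rewrite ler_pM2l //; apply: le_trans H3 _; apply: le_trans H6 _.
apply/eqP; rewrite -subr_eq0 -cmod_eq0 eq_le cmod_ge0 andbT.
by apply/ler_addgt0Pr => e e0; rewrite add0r; exact: close.
Qed.

End Model.

(** * The iteration *)

(** Both sequences stay bounded in terms of E0, so 1/e_n increases by a fixed
    amount at each step; once e_n is small, d_n is contracted towards a multiple
    of it. The rank N depends only on the constants, which is what uniformity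
    on compact sets needs. *)
Lemma coupled_decay (R : realType) (a b k E0 eta : R) :
  0 <= a -> a < 1 -> 0 <= b -> 0 < k -> 0 < E0 -> 0 < eta ->
  exists N, forall e d : nat -> R,
    (forall n, 0 < e n) -> (forall n, 0 < d n) -> e 0%N <= E0 -> d 0%N <= E0 ->
    (forall n, e n.+1 <= e n) -> (forall n, d n.+1 <= a * d n + b * e n) ->
    (forall n m, 0 < m -> m <= (e n)^-1 -> m <= (d n)^-1 ->
       (e n)^-1 + k * m <= (e n.+1)^-1) ->
    forall n, (N <= n)%N -> e n <= eta /\ d n <= eta.
Proof.
move=> a0 a1 b0 k0 E00 eta0.
pose D0 := E0 + b * E0 / (1 - a).
have ca : 0 < 1 - a by lra.
have bE : 0 <= b * E0 / (1 - a).
  by apply: divr_ge0; [apply: mulr_ge0 => //; exact: ltW|exact: ltW].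
have D00 : 0 < D0 by rewrite /D0; lra.
have D0E : a * D0 + b * E0 <= D0.
  have : b * E0 / (1 - a) * (1 - a) = b * E0 by rewrite divfK ?gt_eqF.
  have : a * E0 <= 1 * E0 by rewrite ler_pM2r // ltW.
  by rewrite /D0; lra.
pose m := D0^-1.
have m0 : 0 < m by rewrite invr_gt0.
(* the second bound makes the contribution b eta' / (1 - a) of the first
   sequence to the limit of the second at most eta / 2 *)
pose eta' := Num.min eta ((1 - a) * eta / (2 * (b + 1))).
have b1 : 0 < 2 * (b + 1) by lra.
have eta'0 : 0 < eta' by rewrite lt_min eta0 /= divr_gt0 // mulr_gt0.
have eta'b : b * eta' <= (1 - a) * eta / 2.
  have : eta' * (2 * (b + 1)) <= (1 - a) * eta.
    by rewrite -ler_pdivlMr // ge_min lexx orbT.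
  by lra.
have eta'e : eta' <= eta by rewrite ge_min lexx.
have km : 0 < k * m by rewrite mulr_gt0.
pose N1 := (Num.truncn (eta'^-1 / (k * m))).+1.
have [N2 HN2] : exists N2, forall j, (N2 <= j)%N -> a ^+ j * D0 <= eta / 2.
  have an : `|a| < 1 by rewrite ger0_norm.
  have q0 : 0 < eta / 2 / D0 by rewrite !divr_gt0.
  have /cvgrPdist_le/(_ _ q0)[N _ HN] := cvg_expr an.
  exists N => j /HN /=; rewrite sub0r normrN ger0_norm ?exprn_ge0 //.
  by rewrite ler_pdivlMr.
exists (N1 + N2)%N => e d e0 d0 eE dE e_dec d_rec e_inc.
have eE' n : e n <= E0 by elim: n => [//|n IH]; exact: le_trans (e_dec n) IH.
have dD n : d n <= D0.
  elim: n => [|n IH]; first by rewrite /D0; lra.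
  apply: le_trans (d_rec n) _; apply: le_trans D0E.
  by apply: lerD; apply: ler_wpM2l.
have grow n : n%:R * (k * m) <= (e n)^-1.
  elim: n => [|n IH]; first by rewrite mul0r invr_ge0 ltW.
  apply: le_trans (e_inc n m m0 _ _).
  - by rewrite -natr1; lra.
  - rewrite lef_pV2 ?posrE //; apply: le_trans (eE' n) _; rewrite /D0; lra.
  - by rewrite lef_pV2 ?posrE.
have small n : (N1 <= n)%N -> e n <= eta'.
  move=> Nn; rewrite -lef_pV2 ?posrE //; apply: le_trans (grow n).
  rewrite -ler_pdivrMr //; apply/ltW; apply: lt_le_trans (truncnS_gt _) _.
  by rewrite ler_nat.
move=> n Nn; split.
  by apply: le_trans (small n _) eta'e; exact: leq_trans (leq_addr _ _) Nn.
have contr j : d (N1 + j)%N <= a ^+ j * D0 + eta / 2.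
  elim: j => [|j IH].
    by rewrite addn0 expr0 mul1r; have := dD N1; lra.
  rewrite addnS exprS; apply: le_trans (d_rec _) _.
  have := small (N1 + j)%N (leq_addr _ _) => S1.
  have := ler_wpM2l b0 S1; have := ler_wpM2l a0 IH; lra.
have Nj : (N1 <= n)%N by exact: leq_trans (leq_addr _ _) Nn.
rewrite -(subnKC Nj); apply: le_trans (contr _) _.
by have := HN2 (n - N1)%N ltac:(by rewrite leq_subRL); lra.
Qed.

Lemma compact_in_bidisk (R : realType) (K : set (R[i] * R[i])) :
  K `<=` bidisk -> compact K ->
  exists2 r : R, r < 1 & forall l, K l -> rnorm l <= r.
Proof.
move=> Kb cK; have [K0|K0] := pselect (K !=set0); last first.
  by exists 0 => // l Kl; exfalso; apply: K0; exists l.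
have cont : {within K, continuous (@rnorm R (R[i] * R[i])%type)}.
  apply: continuous_subspaceT => p; apply/cvgrPdist_lt => e e0.
  apply/(@nbhs_rnormP R (R[i] * R[i])%type p); exists e => // q qp.
  apply: le_lt_trans qp.
  have := ler_dist_dist q p.
  rewrite (norm_rnorm q) (norm_rnorm p) (norm_rnorm (q - p)) -rcB normE cmod_rc.
  by rewrite lecR => h; rewrite distrC; exact: h.
have [c cK' cmax] := compact_EVT_max K0 cK cont.
exists (rnorm c) => [|l Kl]; last by apply: cmax; rewrite inE.
by apply: bidisk_rnorm; apply: Kb; rewrite inE in cK'.
Qed.

Lemma uniform_cvg_cst (R : realType) (T : choiceType) (V : normedModType R[i])
    (K : set T) (f : nat -> T -> V) (v : V) :
  (forall e : R, 0 < e -> exists N, forall n, (N <= n)%N ->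
     forall x, K x -> rnorm (f n x - v) < e) ->
  {uniform K, f @ \oo --> (fun=> v)}.
Proof.
move=> H P /uniform_nbhs[E [+ EP]]; rewrite -entourage_ballE => -[d /= /gt0_rc[x -> x0] Ed].
have [N HN] := H x x0; exists N => // n /= Nn; apply: EP => y Ky.
apply: Ed => /=; rewrite -ball_normE /= norm_rnorm ltcR rnorm_distC.
exact: HN.
Qed.

Theorem theorem2p12 (R : realType) (phi psi : R[i] * R[i] -> R[i])
    (tau1 sigma : R[i]) :
  let F := fun l : R[i] * R[i] => (phi l, psi l) in
  holo_self_bidisk F ->
  left_type1 phi ->
  right_type2 psi ->
  common_DW_point phi tau1 ->
  circle sigma ->
  right_type2_DW psi (tau1, sigma) ->
  ~ C_point phi (tau1, sigma) ->
  forall K : set (R[i] * R[i]), K `<=` bidisk -> compact K ->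
    {uniform K, (fun n => iter n F) @ \oo --> (fun=> (tau1, sigma))}.
Proof.
move=> F [Fh Fd] _ _ [tc DW] sc [M [_ _ [_ pnt] [v vY v1] _]] nC K Kb cK.
have phid z w : disk z -> disk w -> differentiable phi (z, w).
  by move=> zd wd; exact: (differentiable_fst (Fh (z, w) (conj zd wd))).
have phiD z w : disk z -> disk w -> disk (phi (z, w)).
  by move=> zd wd; have [] := Fd (z, w) (conj zd wd).
have phiW z w : disk z -> disk w -> horo tau1 (phi (z, w)) <= horo tau1 z.
  by move=> zd wd; have [] := wolff (DW w wd) zd.
have pD l : bidisk l -> disk (flip psi l).
  by move=> [l1 l2]; have [] := Fd (l.2, l.1) (conj l2 l1).
have J := model_julia pD sc tc vY pnt.
set a := rnorm (pr1 _ v) ^+ 2 in J; set b := rnorm (pr2 _ v) ^+ 2 in J.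
have a1 : a < 1.
  move: v1; rewrite norm_rnorm ltcR => v1.
  by rewrite /a -(expr1n _ 2) ltrXn2r // rnorm_ge0.
have [k k0 Hk] : exists2 k : R, 0 < k & forall z w m, disk z -> disk w -> 0 < m ->
    m <= (horo tau1 z)^-1 -> m <= (horo sigma w)^-1 ->
    (horo tau1 z)^-1 + k * m <= (horo tau1 (phi (z, w)))^-1.
  apply: (horo_increment tc sc phid phiD phiW); apply: contrapT => nd.
  exact/nC/(phi_C_point tc sc phid phiD phiW nd).
have [r r1 Kr] := compact_in_bidisk Kb cK.
pose E0 := 4 / (1 - r).
have E00 : 0 < E0 by rewrite divr_gt0 // subr_gt0.
have horoK t z : circle t -> disk z -> cmod z <= r -> horo t z <= E0.
  move=> tt zd zr; have zp := disk_cmod2 zd; have /circle_cmod t1 := tt.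
  have /disk_cmod z1 := zd; have z0 := cmod_ge0 z.
  rewrite /horo /E0 ler_pdivrMr // mulrAC ler_pdivlMr ?subr_gt0 //.
  have B : cmod2 (t - z) <= 4.
    have -> : (4 : R) = 2 ^+ 2 by ring.
    by rewrite -cmod_le //; apply: le_trans (cmodB _ _) _; lra.
  have D : 1 - r <= 1 - cmod2 z by rewrite -sqr_cmod; nra.
  by apply: ler_pM => //; rewrite ?cmod2_ge0 // subr_ge0 ltW.
apply: uniform_cvg_cst => e e0.
have e4 : 0 < e / 4 by rewrite divr_gt0.
have [N HN] := coupled_decay (sqr_ge0 _ : 0 <= a) a1 (sqr_ge0 _ : 0 <= b) k0 E00 e4.
exists N => n Nn l Kl.
have lb j : bidisk (iter j F l) by elim: j => [|j IH]; [exact: Kb|exact: Fd].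
have step j : iter j.+1 F l = (phi (iter j F l), psi (iter j F l)) by [].
have [c1 c2] := rnorm_le_pair l; have lr := Kr l Kl.
have pE (q : R[i] * R[i]) : q = (q.1, q.2) by case: q.
have [] := HN (fun j => horo tau1 (iter j F l).1)
  (fun j => horo sigma (iter j F l).2) _ _ _ _ _ _ _ n Nn.
- by move=> j; apply: horo_gt0 => //; have [] := lb j.
- by move=> j; apply: horo_gt0 => //; have [] := lb j.
- by apply: horoK => //=; [have [] := lb 0%N|exact: le_trans c1 lr].
- by apply: horoK => //=; [have [] := lb 0%N|exact: le_trans c2 lr].
- by move=> j; have [j1 j2] := lb j; have := phiW _ _ j1 j2; rewrite -pE.
- move=> j; have [j1 j2] := lb j.
  have := J ((iter j F l).2, (iter j F l).1) (conj j2 j1).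
  by rewrite step /flip /= -pE.
- move=> j m m0 h1 h2; have [j1 j2] := lb j.
  by have := Hk _ _ _ j1 j2 m0 h1 h2; rewrite -pE.
have [n1 n2] := lb n => h1 h2.
have D1 := dist_le_horo tc n1; have D2 := dist_le_horo sc n2.
rewrite rnorm_pair /= gt_max !(cmodBC _ tau1) !(cmodBC _ sigma).
by apply/andP; split; lra.
Qed.
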